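(* Let $m\ge 2$ and let $u=(u_i)_{i=1}^m:\mathbb{R}^n\to\mathbb{R}^m$ be a classical solution of $$-\operatorname{div}\big(\Phi'(|\nabla u_i|^2)\nabla u_i\big)=H_i(u)\quad\text{in }\mathbb{R}^n,\qquad i=1,\dots,m,$$ with $\tilde H(u)\le 0$. Suppose that $\alpha$ is a constant such that $$\alpha\ge\alpha^*:=\sup_{s>0}\left\{\frac{2s\Phi'(s)}{\Phi(s)}\right\}.$$ Then the function $$I_\alpha(r):=\frac{1}{r^{n-\alpha}}\int_{B_r}\left[\sum_{i=1}^m\Phi(|\nabla u_i|^2)-2\tilde H(u)\right],\qquad r>0,$$ is a monotone nondecreasing function of $r$. In particular, $$I_\alpha'(r)\ge\frac{2}{r^{n-\alpha}}\int_{\partial B_r}\sum_{i=1}^m\Phi'(|\nabla u_i|^2)(\partial_ru_i)^2-\frac{2\alpha}{r^{n-\alpha+1}}\int_{B_r}\tilde H(u).$$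
   Context: Standing assumptions: $\Phi\in C^2(\mathbb{R}^+)$, $\Phi(0)=0$, and $\Phi(s)$, $\Phi'(s)$ and $\Phi'(s)+2s\Phi''(s)$ are positive for $s>0$. Each $H_i\in C^1(\mathbb{R}^m)$ is real valued; with $\partial_jH_i(u)=\partial H_i(u)/\partial u_j$ one assumes $\partial_iH_j(u)\,\partial_jH_i(u)>0$ for $1\le i\le j\le m$. $\tilde H:\mathbb{R}^m\to\mathbb{R}$ is a function (assumed to exist) with $\partial_i\tilde H=H_i$ for all $i$. $B_r$ is the ball of radius $r$ centered at the origin in $\mathbb{R}^n$ and $\partial_r$ is the radial derivative. *)

(* Defs.v *)
From HB Require Import structures.
From mathcomp Require Import all_boot all_order all_algebra.
From mathcomp Require Import all_classical all_reals all_analysis measurable_realfun.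
Import Order.TTheory GRing.Theory Num.Theory.
Import numFieldNormedType.Exports.

Set Implicit Arguments.
Unset Strict Implicit.
Unset Printing Implicit Defensive.

Local Open Scope classical_set_scope.
Local Open Scope ring_scope.

(* R^n is 'rV[R]_n.  Its sigma-algebra is generated by the coordinate maps:
   these are the Borel sets. *)
Definition rV_display : measure_display.
Proof. exact: default_measure_display. Qed.

Section rV_measurable.
Context {R : realType} {n : nat}.

Let coord (i : 'I_n) (x : 'rV[R]_n) : R := x ord0 i.

Let rV_set0 : g_sigma_preimage coord set0.
Proof. exact: sigma_algebra0. Qed.

Let rV_setC A : g_sigma_preimage coord A -> g_sigma_preimage coord (~` A).
Proof. exact: sigma_algebraC. Qed.

Let rV_bigcup (F : _^nat) : (forall i, g_sigma_preimage coord (F i)) ->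
  g_sigma_preimage coord (\bigcup_i (F i)).
Proof. exact: sigma_algebra_bigcup. Qed.

HB.instance Definition _ := @isMeasurable.Build rV_display
  'rV[R]_n (g_sigma_preimage coord) rV_set0 rV_setC rV_bigcup.

Lemma measurable_coord (i : 'I_n) :
  measurable_fun [set: 'rV[R]_n] (fun x => x ord0 i).
Proof.
move=> _ Y mY; rewrite setTI; apply: sub_sigma_algebra => /=.
rewrite -bigcup_seq/=; exists i => /=; first by rewrite mem_index_enum.
by exists Y => //; rewrite setTI.
Qed.

Lemma measurable_fun_rV d (T : measurableType d) (f : T -> 'rV[R]_n) :
  (forall i, measurable_fun [set: T] (fun t => f t ord0 i)) ->
  measurable_fun [set: T] f.
Proof.
move=> mf; apply: (@measurability _ _ _ _ _ _
  (\big[setU/set0]_(i < n) preimage_set_system setT (coord i) measurable)) => //.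
move=> _ [B + <-]; rewrite -bigcup_seq => -[i _ [C mC <-]].
by rewrite !setTI -comp_preimage -[X in measurable X]setTI; exact: mf.
Qed.

End rV_measurable.

Section rV_cons.
Context {R : realType} (n : nat).

Definition rV_cons (p : measurableTypeR R * 'rV[R]_n) : 'rV[R]_n.+1 :=
  row_mx (const_mx p.1 : 'rV[R]_1) p.2.

Definition rV_uncons (x : 'rV[R]_n.+1) : measurableTypeR R * 'rV[R]_n :=
  (x ord0 ord0, \row_i x ord0 (lift ord0 i)).

Lemma rV_consK : cancel rV_cons rV_uncons.
Proof.
move=> [a v]; rewrite /rV_uncons /rV_cons; congr pair.
  have -> : ord0 = lshift n (ord0 : 'I_1) by apply/val_inj.
  by rewrite (row_mxEl (const_mx a : 'rV[R]_1)) mxE.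
apply/rowP => i; rewrite mxE.
have -> : lift ord0 i = rshift 1 i by apply/val_inj.
by rewrite (row_mxEr (const_mx a : 'rV[R]_1)).
Qed.

Lemma measurable_rV_cons : measurable_fun setT rV_cons.
Proof.
apply: measurable_fun_rV => i.
have [j ->|->] := unliftP ord0 i; last first.
  apply: (eq_measurable_fun fst) => //.
  by move=> p _; rewrite -[RHS]/((rV_uncons (rV_cons p)).1) rV_consK.
apply: (eq_measurable_fun ((fun v : 'rV_n => v ord0 j) \o snd)).
  by move=> p _; rewrite -{1}(rV_consK p)/= mxE.
apply: (@measurableT_comp _ _ _ _ _ _ (fun v : 'rV_n => v ord0 j)) => //.
exact: measurable_coord.
Qed.

Lemma measurable_rV_uncons : measurable_fun setT rV_uncons.
Proof.
apply/measurable_fun_pair; first exact: measurable_coord.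
apply: measurable_fun_rV => i.
apply: (eq_measurable_fun (fun x : 'rV_n.+1 => x ord0 (lift ord0 i))).
  by move=> x _; rewrite mxE.
exact: measurable_coord.
Qed.

Variable mu : {sigma_finite_measure set 'rV[R]_n -> \bar R}.

Definition lebesgue_cons : set 'rV[R]_n.+1 -> \bar R :=
  pushforward (lebesgue_measure \x mu)%E rV_cons.

Let lebesgue_cons0 : lebesgue_cons set0 = 0%E.
Proof. by rewrite /lebesgue_cons /pushforward preimage_set0 measure0. Qed.

Let lebesgue_cons_ge0 A : (0 <= lebesgue_cons A)%E.
Proof. by rewrite /lebesgue_cons /pushforward; exact: measure_ge0. Qed.

Let lebesgue_cons_sigma_additive : semi_sigma_additive lebesgue_cons.
Proof.
have mc := measurable_rV_cons; exact: measure_semi_sigma_additive.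
Qed.

HB.instance Definition _ := isMeasure.Build _ _ _ lebesgue_cons
  lebesgue_cons0 lebesgue_cons_ge0 lebesgue_cons_sigma_additive.

Let lebesgue_cons_sigma_finite : sigma_finite setT lebesgue_cons.
Proof.
have /sigma_finiteP[F [TF ndF Foo]] := sigma_finiteT (@lebesgue_measure R).
have /sigma_finiteP[G [TG ndG Goo]] := sigma_finiteT mu.
exists (fun k => rV_uncons @^-1` (F k `*` G k)).
  rewrite -preimage_bigcup; apply/esym; rewrite -subTset => x _ /=.
  case: (rV_uncons x) => a v.
  have [i _ Fia] : (\bigcup_i F i) a by rewrite -TF.
  have [j _ Gjv] : (\bigcup_i G i) v by rewrite -TG.
  exists (maxn i j) => //; split => /=.
    by move: a Fia; exact/subsetPset/ndF/leq_maxl.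
  by move: v Gjv; exact/subsetPset/ndG/leq_maxr.
move=> k; have [mF Fkoo] := Foo k; have [mG Gkoo] := Goo k; split.
  rewrite -[X in measurable X]setTI.
  by apply: measurable_rV_uncons => //; exact: measurableX.
rewrite /lebesgue_cons /pushforward -comp_preimage.
have -> : rV_uncons \o rV_cons = id by apply/funext => p; exact: rV_consK.
by rewrite preimage_id product_measure1E// lte_mul_pinfty// ge0_fin_numE.
Qed.

HB.instance Definition _ := Measure_isSigmaFinite.Build _ _ _ lebesgue_cons
  lebesgue_cons_sigma_finite.

End rV_cons.

(* Lebesgue measure on R^n, as the n-fold product of Lebesgue measure on R. *)
Fixpoint lebesgue_rV {R : realType} (n : nat) :
    {sigma_finite_measure set 'rV[R]_n -> \bar R} :=
  match n with
  | 0 => \d_(0 : 'rV[R]_0)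
  | n'.+1 => lebesgue_cons (lebesgue_rV n')
  end.

Section euclidean.
Context {R : realType} {n : nat}.
Implicit Types (x : 'rV[R]_n) (r : R).

(* The library's norm on 'rV[R]_n is the sup norm. *)
Definition enorm x : R := Num.sqrt (\sum_i x ord0 i ^+ 2).

Definition eball r : set 'rV[R]_n := [set x | enorm x < r].

Definition esphere r : set 'rV[R]_n := [set x | enorm x = r].

Definition radial_proj r x : 'rV[R]_n := (r / enorm x) *: x.

Lemma measurable_enorm : measurable_fun [set: 'rV[R]_n] enorm.
Proof.
apply: (@measurableT_comp _ _ _ _ _ _ (@Num.sqrt R)).
  by apply: continuous_measurable_fun; exact: sqrt_continuous.
apply: measurable_sum => i; apply: measurable_funX.
exact: measurable_coord.
Qed.

Lemma measurable_eball r : measurable (eball r).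
Proof.
rewrite -[X in measurable X]setTI.
have -> : eball r = enorm @^-1` `]-oo, r[%classic.
  by apply/seteqP; split => x /=; rewrite in_itv.
by apply: measurable_enorm => //; exact: measurable_itv.
Qed.

Lemma measurable_radial_proj r : measurable_fun [set: 'rV[R]_n] (radial_proj r).
Proof.
apply: measurable_fun_rV => i.
apply: (eq_measurable_fun (fun x : 'rV[R]_n => r * enorm x `^ (-1) * x ord0 i)).
  by move=> x _; rewrite mxE powR_inv1// sqrtr_ge0.
apply: measurable_funM; last exact: measurable_coord.
apply: measurable_funM => //.
apply: (@measurableT_comp _ _ _ _ _ _ (@powR R ^~ (-1))) => //.
exact: measurable_enorm.
Qed.

Definition cone_volume r : set 'rV[R]_n -> \bar R :=
  pushforward (mrestr (lebesgue_rV n) (measurable_eball r)) (radial_proj r).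

Let cone_volume0 r : cone_volume r set0 = 0%E.
Proof. by have mp := measurable_radial_proj r; exact: measure0. Qed.

Let cone_volume_ge0 r A : (0 <= cone_volume r A)%E.
Proof. by rewrite /cone_volume /pushforward; exact: measure_ge0. Qed.

Let cone_volume_sigma_additive r : semi_sigma_additive (cone_volume r).
Proof.
by have mp := measurable_radial_proj r; exact: measure_semi_sigma_additive.
Qed.

HB.instance Definition _ r := isMeasure.Build _ _ _ (cone_volume r)
  (cone_volume0 r) (@cone_volume_ge0 r) (@cone_volume_sigma_additive r).

(* Surface measure on the sphere of radius r > 0 (n >= 1), as in the polar
   coordinates formula:
     sigma_r(A) = (n / r) * |{x in B_r | r x / |x| in A}|,
   since the solid cone of apex 0 over a part of area a of the sphere has
   volume a r / n.  For n = 1 it is the counting measure on {-r, r}. *)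
Definition surface_measure r : set 'rV[R]_n -> \bar R :=
  mscale `|n%:R / r|%:nng (cone_volume r).

HB.instance Definition _ r := Measure.on (surface_measure r).

Definition basis_vec (i : 'I_n) : 'rV[R]_n := delta_mx ord0 i.

Definition partial (i : 'I_n) (f : 'rV[R]_n -> R) (x : 'rV[R]_n) : R :=
  'D_(basis_vec i) f x.

Definition C1 (f : 'rV[R]_n -> R) : Prop :=
  forall i, (forall x, derivable f x (basis_vec i)) /\ continuous (partial i f).

Definition C2 (f : 'rV[R]_n -> R) : Prop :=
  C1 f /\ forall i, C1 (partial i f).

Definition gradient (f : 'rV[R]_n -> R) (x : 'rV[R]_n) : 'rV[R]_n :=
  \row_i partial i f x.

Definition divergence (V : 'rV[R]_n -> 'rV[R]_n) (x : 'rV[R]_n) : R :=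
  \sum_i partial i (fun y => V y ord0 i) x.

Definition radial_derivative (f : 'rV[R]_n -> R) (x : 'rV[R]_n) : R :=
  'D_((enorm x)^-1 *: x) f x.

End euclidean.

Section quasilinear_system.
Context {R : realType} {n m : nat}.
Implicit Types (Phi : R -> R) (u : 'rV[R]_n -> 'rV[R]_m).

(* Phi is a total function R -> R of which only the values on [0, +oo[ matter.
   Being C^2 is required on ]0, +oo[, with mere continuity at 0: this is implied
   by C^2 up to 0, and it includes the p-Laplacian, Phi(s) = (2 / p) s^(p / 2). *)
Definition C2_Rplus Phi : Prop :=
  [/\ {within `[0, +oo[, continuous Phi},
      forall s, 0 < s -> derivable Phi s 1,
      forall s, 0 < s -> derivable Phi^`()%classic s 1 &
      forall s, 0 < s -> {for s, continuous Phi^`(2)%classic}].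

(* Phi'(|grad f|^2) grad f.  Where grad f = 0 this is 0 whatever the value of
   the (possibly meaningless) derivative Phi^`() at 0. *)
Definition flux Phi (f : 'rV[R]_n -> R) (x : 'rV[R]_n) : 'rV[R]_n :=
  Phi^`()%classic (enorm (gradient f x) ^+ 2) *: gradient f x.

Definition component u (i : 'I_m) (x : 'rV[R]_n) : R := u x ord0 i.

(* If Phi is C^2 up to 0, the condition that the flux be C^1 follows from the
   first one. *)
Definition classical_solution Phi (H : 'I_m -> 'rV[R]_m -> R) u : Prop :=
  forall i : 'I_m,
    [/\ C2 (component u i),
        forall j : 'I_n, C1 (fun x => flux Phi (component u i) x ord0 j) &
        forall x, - divergence (flux Phi (component u i)) x = H i (u x)].

Definition alpha_star Phi : \bar R :=
  ereal_sup [set (2 * s * Phi^`()%classic s / Phi s)%:E | s in [set s : R | 0 < s]].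

Definition I_alpha Phi (Ht : 'rV[R]_m -> R) u (alpha r : R) : R :=
  (r `^ (n%:R - alpha))^-1 *
  \int[lebesgue_rV n]_(x in eball r)
    (\sum_(i < m) Phi (enorm (gradient (component u i) x) ^+ 2)
     - 2 * Ht (u x)).

End quasilinear_system.

(* Main.v *)
From HB Require Import structures.
Require Import Defs.
From mathcomp Require Import all_boot all_order all_algebra fingroup perm.
From mathcomp Require Import all_classical all_reals all_analysis measurable_realfun.
From mathcomp Require Import ring lra.
Import Order.TTheory GRing.Theory Num.Theory.
Import numFieldNormedType.Exports.
Set Implicit Arguments.
Unset Strict Implicit.
Unset Printing Implicit Defensive.
Local Open Scope classical_set_scope.
Local Open Scope ring_scope.

(** The theorem expresses the invariance of the energy under dilations.  Write
    V_i = Phi'(|grad u_i|^2) grad u_i for the flux, E = sum_i Phi(|grad u_i|^2),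
    L = E - 2 Ht(u) for the Lagrangian density, B for the ball of radius r.  The
    equations say that the tensor T = sum_i 2 V_i (x) grad u_i - L Id is
    divergence free, so that the vector field W = T x satisfies
    div W = tr T = sum_i 2 V_i . grad u_i - n L.  On the boundary of B one has
    x . W = 2 sum_i (x . V_i) (x . grad u_i) - r^2 L, and the divergence theorem
    yields the Pohozaev identity [Pohozaev].

    By definition of alpha^*, sum_i 2 V_i . grad u_i <= alpha E
    = alpha (L + 2 Ht(u)).  Inserted in the Pohozaev identity, this bounds the
    integral of L over the sphere from below by (n - alpha) / r times its
    integral over B plus the two terms of the statement.  In polar coordinates
    the integral of L over the sphere is the derivative of the integral over B,
    and the bound becomes the announced inequality for the derivative of
    I_alpha, whose right-hand side is nonnegative since Ht(u) <= 0.

    Three points need an argument.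

    Regularity.  Phi may be singular at 0, and W has to be C^1 nevertheless.
    Since Phi(s) <= 2 s Phi'(s) [Phi_le], the energy density
    Phi(|grad f|^2) is squeezed between 0 and 2 V . grad f, so that its
    derivative vanishes at the critical points of f [energy_is_derive].

    Polar coordinates.  The surface measure of a set is n / r times the volume of
    the cone over it, hence the integral of f over the sphere is n / r times the
    integral over B of the function f (r x / |x|), which is constant along rays.
    Its integrals over balls are governed by the dilation invariance of Lebesgue
    measure, and [ball_int_derive] follows by comparing f with it on thin shells.

    The divergence theorem on B.  Fubini's theorem and the one-dimensional
    fundamental theorem of calculus show that the integral over B of a partial
    derivative of F is zero when F vanishes on the sphere [ball_int_partial].
    Applied to the components of (r^2 - |x|^2) W this gives
    [weighted_divergence], and the divergence theorem is its derivative with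
    respect to r [divergence_theorem]. *)

(** * Differential calculus for real functions of several variables *)

Lemma continuous_sumr (R : realType) (T : topologicalType) (n : nat)
    (f : 'I_n -> T -> R) :
  (forall i, continuous (f i)) -> continuous (fun y => \sum_i f i y).
Proof.
by move=> cf; apply: continuous_big => //; exact: add_continuous.
Qed.

Lemma continuous_addr (R : realType) (T : topologicalType) (f g : T -> R) :
  continuous f -> continuous g -> continuous (fun x => f x + g x).
Proof. by move=> cf cg x; exact: (@cvgD _ R^o _ _ _ f g _ _ (cf x) (cg x)). Qed.

Lemma continuous_mulr (R : realType) (T : topologicalType) (f g : T -> R) :
  continuous f -> continuous g -> continuous (fun x => f x * g x).
Proof. by move=> cf cg x; exact: (@cvgM R _ _ _ f g _ _ (cf x) (cg x)). Qed.

Section dot_product.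
Context {R : realType} {n : nat}.
Implicit Types x y v : 'rV[R]_n.

Definition rdot x y : R := \sum_i x ord0 i * y ord0 i.

Lemma rdotC x y : rdot x y = rdot y x.
Proof. by apply: eq_bigr => i _; rewrite mulrC. Qed.

Lemma rdot_is_linear x : linear (rdot x).
Proof.
move=> a y z; rewrite /rdot scaler_sumr -big_split.
by apply: eq_bigr => i _; rewrite !mxE mulrDr [X in X + _]mulrCA.
Qed.

HB.instance Definition _ x :=
  GRing.isLinear.Build R 'rV[R]_n R *:%R (rdot x) (rdot_is_linear x).

Lemma rdotZr a x y : rdot x (a *: y) = a * rdot x y.
Proof. by rewrite linearZ. Qed.

Lemma rdotZl a x y : rdot (a *: x) y = a * rdot x y.
Proof. by rewrite rdotC rdotZr rdotC. Qed.

Lemma coord_le_norm x i : `|x ord0 i| <= `|x|.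
Proof.
rewrite [leRHS]/Num.Def.normr/= mx_normrE.
exact: (le_bigmax _ (fun p : 'I_1 * 'I_n => `|x p.1 p.2|) (ord0, i)).
Qed.

Lemma norm_le_coord x (a : R) :
  0 <= a -> (forall i, `|x ord0 i| <= a) -> `|x| <= a.
Proof.
move=> a0 xa; rewrite [leLHS]/Num.Def.normr/= mx_normrE.
by apply: bigmax_le => //= -[i j] _ /=; rewrite ord1.
Qed.

Lemma rdot_continuous x : continuous (rdot x).
Proof.
apply: continuous_sumr => i.
by apply: continuous_mulr; [exact: cst_continuous|exact: coord_continuous].
Qed.

End dot_product.

Section lines.
Context {R : realType} {V : normedModType R}.

Lemma is_derive_line (f : V -> R) (x v : V) (t : R) :
  derivable f (x + t *: v) v ->
  is_derive t 1 (fun s => f (x + s *: v)) ('D_v f (x + t *: v)).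
Proof.
move=> df.
have E : (fun h : R => h^-1 *: (f (h *: v + (x + t *: v)) - f (x + t *: v))) =
   (fun h : R => h^-1 *: (((fun s => f (x + s *: v)) \o shift t) (h *: 1) -
     (fun s => f (x + s *: v)) t)).
  apply/funext => h /=; congr (_ *: (f _ - _)).
  by rewrite [_ *: 1]mulr1 scalerDl addrCA addrA.
apply: DeriveDef.
  by move: df; rewrite /derivable /= E.
by rewrite /derive /= -E.
Qed.

Lemma line_MVT (f : V -> R) (x v : V) (t : R) :
  (forall s : R, `|s| <= `|t| -> derivable f (x + s *: v) v) ->
  exists2 c : R, `|c| <= `|t| & f (x + t *: v) - f x = t * 'D_v f (x + c *: v).
Proof.
move=> df; pose g (s : R) := f (x + s *: v); pose dg (s : R) : R := 'D_v f (x + s *: v).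
have dgP (s : R) : `|s| <= `|t| -> is_derive s 1 g (dg s).
  by move=> st; apply: is_derive_line; exact: df.
have cg (a b : R) : (forall s, s \in `[a, b] -> `|s| <= `|t|) ->
    {within `[a, b], continuous g}.
  move=> ab; apply: derivable_within_continuous => s sab.
  by have [] := dgP s (ab _ sab).
have E0 : f x = g 0 by rewrite /g scale0r addr0.
rewrite E0.
have [t0|t0] := leP 0 t.
  have tt s : s \in `[0, t] -> `|s| <= `|t|.
    by rewrite in_itv/= => /andP[s0 st]; rewrite !ger0_norm.
  have [c ct E] := MVT_segment t0
    (fun s (st : s \in `]0, t[) => dgP s (tt s (subset_itv_oo_cc st))) (cg _ _ tt).
  exists c; first exact: tt.
  by rewrite -/(g t) E subr0 mulrC.
have tt s : s \in `[t, 0] -> `|s| <= `|t|.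
  rewrite in_itv/= => /andP[st s0]; rewrite !ler0_norm ?lerN2 //.
  exact: ltW.
have [c ct E] := MVT_segment (ltW t0)
  (fun s (st : s \in `]t, 0[) => dgP s (tt s (subset_itv_oo_cc st))) (cg _ _ tt).
exists c; first exact: tt.
by rewrite -/(g t) -opprB E sub0r mulrN opprK mulrC.
Qed.

End lines.

Section C1_differentiable.
Context {R : realType} {n : nat}.
Implicit Types (f : 'rV[R]_n -> R) (x h : 'rV[R]_n).

Let trunc h k : 'rV[R]_n := \row_i if (i < k)%N then h ord0 i else 0.

Let truncS h (k : 'I_n) : trunc h k.+1 = trunc h k + h ord0 k *: basis_vec k.
Proof.
apply/rowP => i; rewrite !mxE /= ltnS leq_eqVlt.
have [->|ik] := eqVneq i k; first by rewrite eqxx ltnn mulr1 add0r.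
by rewrite -(inj_eq val_inj) in ik; rewrite (negbTE ik) ?andbF mulr0 addr0.
Qed.

(** The point x + h is reached from x by moving one coordinate at a time.  On
    each of these edges the mean value theorem produces a partial derivative at
    a point within distance |h| of x, where continuity of the partial
    derivatives applies. *)
Lemma C1_expansion f x (e : R) : C1 f -> 0 < e ->
  \forall h \near (0 : 'rV[R]_n),
    `|f (x + h) - f x - rdot (gradient f x) h| <= e * `|h|.
Proof.
move=> f1 e0.
have n0 : 0 < n%:R + 1 :> R by rewrite ltr_wpDl.
have e'0 : 0 < e / (n%:R + 1) by rewrite divr_gt0.
have near_d : \forall y \near x, forall i,
    `|partial i f x - partial i f y| < e / (n%:R + 1).
  apply: (@filter_forall _ _ (fun i y =>
    `|partial i f x - partial i f y| < e / (n%:R + 1)) (nbhs x)) => i.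
  have [_ ci] := f1 i; have /cvgrPdist_lt := ci x; exact.
have /nbhs_ballP[d /= d0 dP] := near_d.
apply/nbhs_ballP; exists d => //= h; rewrite -ball_normE /= sub0r normrN => hd.
have step (k : 'I_n) : exists2 y, ball x d y &
   f (x + trunc h k.+1) - f (x + trunc h k) = h ord0 k * partial k f y.
  rewrite truncS addrA.
  have [c ch ->] := @line_MVT _ _ f (x + trunc h k) (basis_vec k) (h ord0 k)
    (fun s _ => (f1 k).1 _).
  exists (x + trunc h k + c *: basis_vec k) => //.
  rewrite -ball_normE /= -addrA opprD addNKr normrN.
  apply: le_lt_trans hd; apply: norm_le_coord => // i.
  rewrite !mxE /=; have [->|ik] := eqVneq i k.
    by rewrite ltnn add0r mulr1 (le_trans ch)// coord_le_norm.
  by rewrite mulr0 addr0; case: ifP; rewrite ?normr0// coord_le_norm.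
have tel : f (x + h) - f x =
    \sum_(k < n) (f (x + trunc h k.+1) - f (x + trunc h k)).
  rewrite -(big_mkord xpredT (fun k => f (x + trunc h k.+1) - f (x + trunc h k))).
  rewrite telescope_sumr//; congr (f _ - f _).
    by congr (_ + _); apply/rowP => i; rewrite !mxE ltn_ord.
  by rewrite -[LHS]addr0; congr (_ + _); apply/rowP => i; rewrite !mxE.
rewrite tel /rdot -sumrB.
apply: (le_trans (ler_norm_sum _ _ _)).
apply: (@le_trans _ _ (\sum_(k < n) (e / (n%:R + 1) * `|h|))).
  apply: ler_sum => k _; have [y /dP yd ->] := step k.
  rewrite mxE mulrC -mulrBl normrM ler_pM//; last exact: coord_le_norm.
  by rewrite distrC; exact/ltW/yd.
rewrite sumr_const card_ord -[_ *+ n]mulr_natl mulrA ler_wpM2r//.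
rewrite mulrCA ger_pMr//.
by rewrite ler_pdivrMr// mul1r lerDl.
Qed.

(** Writing R^o selects the structure of R as a normed module over itself, in
    which the remainder is measured. *)
Lemma C1_diff (f : 'rV[R]_n -> R^o) x : C1 f -> is_diff x f (rdot (gradient f x) : 'rV[R]_n -> R^o).
Proof.
move=> f1.
have E : f \o shift x = cst (f x) + (rdot (gradient f x) : 'rV[R]_n -> R^o) +o_ (0 : 'rV[R]_n) id.
  apply/eqaddoP => e e0; near=> h; rewrite /= !fctE/=.
  have -> : f (h + x) - (f x + rdot (gradient f x) h) =
     f (x + h) - f x - rdot (gradient f x) h by rewrite opprD addrA (addrC h).
  by near: h; exact: C1_expansion.
have c : continuous (rdot (gradient f x)) by exact: rdot_continuous.
have D : 'd f x = rdot (gradient f x) :> ('rV[R]_n -> R^o).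
  exact: (@diff_unique _ _ _ _ (rdot (gradient f x) : {linear 'rV[R]_n -> R^o}) _ c E).
apply: DiffDef => //.
by apply/diff_locallyP; split; rewrite D.
Unshelve. all: by end_near. Qed.

Lemma C1_differentiable f x : C1 f -> differentiable f x.
Proof. by move=> /(C1_diff x) []. Qed.

Lemma C1_continuous f : C1 f -> continuous f.
Proof. by move=> f1 x; exact/differentiable_continuous/C1_differentiable. Qed.

Lemma C1_derivable f x v : C1 f -> derivable f x v.
Proof. by move=> f1; apply/diff_derivable/C1_differentiable. Qed.

Lemma C1_deriveE f x v : C1 f -> 'D_v f x = rdot (gradient f x) v.
Proof.
move=> f1; rewrite deriveE; last exact: C1_differentiable.
by have [_ ->] := C1_diff x f1.
Qed.

Lemma C1_partial_continuous f i : C1 f -> continuous (partial i f).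
Proof. by move=> /(_ i)[]. Qed.

End C1_differentiable.

Section C1_algebra.
Context {R : realType} {n : nat}.
Implicit Types (f g : 'rV[R]_n -> R) (x v : 'rV[R]_n).

Lemma C1_is_partial f i x : C1 f -> is_derive x (basis_vec i) f (partial i f x).
Proof. by move=> f1; apply: DeriveDef => //; exact: C1_derivable. Qed.

Lemma partialE f i (df : 'rV[R]_n -> R) :
  (forall x, is_derive x (basis_vec i) f (df x)) -> partial i f = df.
Proof. by move=> dfE; apply/funext => x; have [_ <-] := dfE x. Qed.

Lemma C1_of_is_derive f (df : 'I_n -> 'rV[R]_n -> R) :
  (forall i x, is_derive x (basis_vec i) f (df i x)) ->
  (forall i, continuous (df i)) -> C1 f.
Proof.
move=> dfE cdf i; split; first by move=> x; have [] := dfE i x.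
by rewrite (partialE (dfE i)).
Qed.

Let cst_derive (c : R) i x :
  is_derive x (basis_vec i) (fun=> c : R) (0 : R).
Proof. exact: is_derive_cst. Qed.

Lemma partial_cst (c : R) i : partial i (fun=> c) = (fun=> 0) :> ('rV[R]_n -> R).
Proof. by apply: partialE => x; exact: cst_derive. Qed.

Lemma C1_cst (c : R) : C1 (fun _ : 'rV[R]_n => c).
Proof. by apply: C1_of_is_derive (cst_derive c) _ => i; exact: cst_continuous. Qed.

Let coord_derive j i x : is_derive x (basis_vec i)
  (fun y : 'rV[R]_n => y ord0 j) (i == j)%:R.
Proof.
have E : (fun h : R => h^-1 *: ((h *: basis_vec i + x) ord0 j - x ord0 j)) @ 0^'
    --> ((i == j)%:R : R).
  apply: (@cvg_trans _ ((cst (i == j)%:R : R -> R) @ 0^')); last exact: cvg_cst.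
  apply: near_eq_cvg; near=> h; rewrite /= !mxE addrK eqxx /= eq_sym.
  rewrite -[_ *: _]/(h^-1 * _) mulrA mulVf ?mul1r//.
  by near: h; exact: nbhs_dnbhs_neq.
apply: DeriveDef; first by apply/cvg_ex; eexists; exact: E.
exact/cvg_lim.
Unshelve. all: by end_near. Qed.

Lemma partial_coord i j :
  partial i (fun y : 'rV[R]_n => y ord0 j) = (fun=> (i == j)%:R).
Proof. by apply: partialE => x; exact: coord_derive. Qed.

Lemma C1_coord j : C1 (fun y : 'rV[R]_n => y ord0 j).
Proof.
by apply: C1_of_is_derive (coord_derive j) _ => i; exact: cst_continuous.
Qed.

Let addr_derive f g i x : C1 f -> C1 g ->
  is_derive x (basis_vec i) (fun y => f y + g y) (partial i f x + partial i g x).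
Proof. by move=> f1 g1; apply: is_deriveD; exact: C1_is_partial. Qed.

Lemma partialD f g i : C1 f -> C1 g ->
  partial i (fun y => f y + g y) = (fun x => partial i f x + partial i g x).
Proof. by move=> f1 g1; apply: partialE => x; exact: addr_derive. Qed.

Lemma C1D f g : C1 f -> C1 g -> C1 (fun y => f y + g y).
Proof.
move=> f1 g1; apply: (C1_of_is_derive (fun i x => addr_derive i x f1 g1)) => i.
by apply: continuous_addr; exact: C1_partial_continuous.
Qed.

Let mulr_derive f g i x : C1 f -> C1 g ->
  is_derive x (basis_vec i) (fun y => f y * g y)
    (f x * partial i g x + g x * partial i f x).
Proof. by move=> f1 g1; apply: is_deriveM; exact: C1_is_partial. Qed.

Lemma partialM f g i : C1 f -> C1 g ->
  partial i (fun y => f y * g y) =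
  (fun x => f x * partial i g x + g x * partial i f x).
Proof. by move=> f1 g1; apply: partialE => x; exact: mulr_derive. Qed.

Lemma C1M f g : C1 f -> C1 g -> C1 (fun y => f y * g y).
Proof.
move=> f1 g1; apply: (C1_of_is_derive (fun i x => mulr_derive i x f1 g1)) => i.
by apply: continuous_addr; apply: continuous_mulr;
  first [exact: C1_partial_continuous|exact: C1_continuous].
Qed.

Lemma partialZ (c : R) f i : C1 f ->
  partial i (fun y => c * f y) = (fun x => c * partial i f x).
Proof.
move=> f1; rewrite (partialM i (C1_cst c) f1) partial_cst.
by apply/funext => x; rewrite mulr0 addr0.
Qed.

Lemma C1Z (c : R) f : C1 f -> C1 (fun y => c * f y).
Proof. exact/C1M/C1_cst. Qed.

Lemma partialN f i : C1 f -> partial i (fun y => - f y) = (fun x => - partial i f x).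
Proof.
move=> f1; transitivity (partial i (fun y => -1 * f y)).
  by congr partial; apply/funext => x; rewrite mulN1r.
by rewrite partialZ//; apply/funext => x; rewrite mulN1r.
Qed.

Lemma C1N f : C1 f -> C1 (fun y => - f y).
Proof.
move=> /(C1Z (-1)) f1.
by rewrite (_ : (fun y => - f y) = (fun y => -1 * f y))//;
  apply/funext => x; rewrite mulN1r.
Qed.

Let sumr_derive m (f : 'I_m -> 'rV[R]_n -> R) i x : (forall k, C1 (f k)) ->
  is_derive x (basis_vec i) (fun y => \sum_k f k y) (\sum_k partial i (f k) x).
Proof.
move=> f1.
have -> : (fun y => \sum_k f k y) = \sum_k f k.
  by apply/funext => y; rewrite fct_sumE.
by apply: is_derive_sum => k; exact: C1_is_partial.
Qed.

Lemma partial_sum m (f : 'I_m -> 'rV[R]_n -> R) i : (forall k, C1 (f k)) ->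
  partial i (fun y => \sum_k f k y) = (fun x => \sum_k partial i (f k) x).
Proof. by move=> f1; apply: partialE => x; exact: sumr_derive. Qed.

Lemma C1_sum m (f : 'I_m -> 'rV[R]_n -> R) :
  (forall k, C1 (f k)) -> C1 (fun y => \sum_k f k y).
Proof.
move=> f1; apply: (C1_of_is_derive (fun i x => sumr_derive i x f1)) => i.
by apply: continuous_sumr => k; exact: C1_partial_continuous.
Qed.

End C1_algebra.

Section Schwarz.
Context {R : realType} {n : nat}.
Implicit Types (f : 'rV[R]_n -> R) (x : 'rV[R]_n).

Lemma norm_basis_vec i : `|basis_vec i : 'rV[R]_n| <= 1.
Proof.
apply: norm_le_coord => // j; rewrite mxE eqxx /=.
by case: eqP => _; rewrite ?normr1 ?normr0.
Qed.

Let continuous_ball2 (A B : 'rV[R]_n -> R) x (e : R) :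
  continuous A -> continuous B -> 0 < e ->
  exists2 d : R, 0 < d &
    forall y, ball x d y -> `|A x - A y| < e /\ `|B x - B y| < e.
Proof.
move=> /(_ x)/cvgrPdist_lt cA /(_ x)/cvgrPdist_lt cB e0.
have /nbhs_ballP[d d0 dA] := cA _ e0; have /nbhs_ballP[d' d'0 dB] := cB _ e0.
exists (Num.min d d') => [|y yd]; first by rewrite lt_min; apply/andP.
by split; [apply: dA|apply: dB]; apply: le_ball yd; rewrite ge_min lexx ?orbT.
Qed.

(** The second difference of f on a small parallelogram does not see the order
    of its two directions, while two mean value steps express it by a mixed
    derivative whose order is the order of the steps. *)
Let second_difference f x (t d : R) i j : C1 f -> C1 (partial j f) ->
  0 < t -> t + t < d ->
  exists2 y, ball x d y &
    f (x + t *: basis_vec i + t *: basis_vec j) - f (x + t *: basis_vec i)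
     - f (x + t *: basis_vec j) + f x = t * (t * partial i (partial j f) y).
Proof.
move=> f1 fj1 t0 td.
pose phi z := f (z + t *: basis_vec i) - f z.
have dphi z : is_derive z (basis_vec j) phi
    (partial j f (z + t *: basis_vec i) - partial j f z).
  apply: is_deriveB; last exact: C1_is_partial.
  have [fdz fD] := C1_is_partial j (z + t *: basis_vec i) f1.
  have E : (fun h : R => h^-1 *: (f (h *: basis_vec j + (z + t *: basis_vec i)) -
       f (z + t *: basis_vec i))) = (fun h : R => h^-1 *: (((fun y => f (y + t *: basis_vec i))
      \o shift z) (h *: basis_vec j) - f (z + t *: basis_vec i))).
    by apply/funext => h /=; rewrite addrA.
  apply: DeriveDef.
    by move: fdz; rewrite /derivable /= E.
  by rewrite -fD /derive /= -E.
have [c ct E1] := @line_MVT _ _ phi x (basis_vec j) t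
  (fun s _ => @ex_derive _ _ _ _ _ _ _ (dphi (x + s *: basis_vec j))).
have [_ phiE] := dphi (x + c *: basis_vec j); rewrite phiE in E1.
have [c' c't E2] := @line_MVT _ _ (partial j f) (x + c *: basis_vec j)
   (basis_vec i) t (fun s _ => @C1_derivable _ _ _ _ _ fj1).
exists (x + c *: basis_vec j + c' *: basis_vec i).
  rewrite -ball_normE /= -addrA opprD addNKr normrN.
  apply: le_lt_trans td; rewrite (le_trans (ler_normD _ _))// !normrZ.
  rewrite (gtr0_norm t0) in ct c't.
  by rewrite lerD// -[leRHS]mulr1 ler_pM// norm_basis_vec.
rewrite -/(partial i (partial j f) _) in E2.
by rewrite -E2 -E1 /phi (addrAC x (t *: basis_vec j)); ring.
Qed.

Lemma Schwarz f x i j : C2 f ->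
  partial i (partial j f) x = partial j (partial i f) x.
Proof.
move=> [f1 f2]; apply/eqP; rewrite -subr_eq0 -normr_eq0; apply/negP => /negP.
set a := partial i _ x; set b := partial j _ x => ab0.
have e0 : 0 < `|a - b| / 2 by rewrite divr_gt0// lt0r ab0 normr_ge0.
have [d d0 dP] := continuous_ball2 x (C1_partial_continuous (i := i) (f2 j))
  (C1_partial_continuous (i := j) (f2 i)) e0.
have t0 : 0 < d / 3 by rewrite divr_gt0.
have td : d / 3 + d / 3 < d by lra.
have [y yd E1] := second_difference x i f1 (f2 j) t0 td.
have [z zd E2] := second_difference x j f1 (f2 i) t0 td.
have [iy _] := dP _ yd; have [_ jz] := dP _ zd.
have yz : partial i (partial j f) y = partial j (partial i f) z.
  have t_neq0 : d / 3 != 0 by rewrite gt_eqF.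
  apply/(mulfI t_neq0)/(mulfI t_neq0); rewrite -[LHS]E1 -[RHS]E2.
  by rewrite (addrAC x (_ *: basis_vec j)); ring.
rewrite -/a in iy; rewrite -/b -yz in jz.
move: (partial i _ y) iy jz => c; move: a b {ab0 e0 dP} => a b ac bc.
by clear -ac bc; have := ler_distD c a b; rewrite (distrC c b); lra.
Qed.

End Schwarz.

(** * Lebesgue measure: rectangles, dilations and permutations of the coordinates *)

Section rectangles.
Context {R : realType} {n : nat}.
Implicit Types (A B : 'I_n -> set R) (x : 'rV[R]_n).

Definition rect A : set 'rV[R]_n := [set x | forall i, A i (x ord0 i)].

Lemma measurable_rect A :
  (forall i, measurable (A i : set (measurableTypeR R))) -> measurable (rect A).
Proof.
move=> mA; have -> : rect A = \bigcap_(i in [set: 'I_n])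
    ((fun x : 'rV[R]_n => x ord0 i) @^-1` A i).
  by apply/seteqP; split => x Ax i; [move=> _; exact: Ax|exact: (Ax i Logic.I)].
apply: fin_bigcap_measurable => // i _.
by rewrite -[X in measurable X]setTI; apply: (@measurable_coord R n i) => //; exact: mA.
Qed.

Lemma rectI A B : rect A `&` rect B = rect (fun i => A i `&` B i).
Proof.
apply/seteqP; split => x; first by move=> [Ax Bx] i; split.
by move=> ABx; split => i; have [] := ABx i.
Qed.

Let box (p : 'rV[rat]_n * nat) : set 'rV[R]_n :=
  rect (fun i => `]ratr (p.1 ord0 i) - p.2.+1%:R^-1, ratr (p.1 ord0 i) + p.2.+1%:R^-1[%classic).

(** The sigma-algebra is generated by the coordinates only, so that an open set
    has to be exhibited as a countable union of boxes: those with rational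
    centre and radius 1 / (k + 1) that it contains. *)
Lemma open_measurable_rV (U : set 'rV[R]_n) : open U -> measurable U.
Proof.
move=> oU.
have -> : U = \bigcup_(p : 'rV[rat]_n * nat) (if `[< box p `<=` U >] then box p else set0).
  apply/seteqP; split => x /=; last first.
    by move=> [p _]; case: ifPn => // /asboolP pU; exact: pU.
  move=> Ux; have /nbhs_ballP[d /= d0 dU] := open_nbhs_nbhs (conj oU Ux).
  near \oo => k.
  have kd : k.+1%:R^-1 < d / 2.
    by near: k; apply: near_infty_natSinv_lt (PosNum _); rewrite divr_gt0.
  have qP i : exists q : rat, ratr q \in `]x ord0 i - k.+1%:R^-1, x ord0 i + k.+1%:R^-1[.
    by apply: rat_in_itvoo; rewrite ltrD2l gt0_cp.
  pose q : 'rV[rat]_n := \row_i projT1 (cid (qP i)).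
  have xq i : `|x ord0 i - ratr (q ord0 i)| < k.+1%:R^-1.
    rewrite mxE; case: cid => r /=; rewrite in_itv/= => /andP[r1 r2].
    by rewrite distrC ltr_distl r1 r2.
  have boxE y : box (q, k) y -> forall i, `|y ord0 i - ratr (q ord0 i)| < k.+1%:R^-1.
    by move=> yq i; have := yq i; rewrite /= in_itv/= ltr_distl.
  have bq : box (q, k) x.
    by move=> i; rewrite /= in_itv/= -ltr_distl.
  exists (q, k) => //.
  suff -> : `[< box (q, k) `<=` U >] by [].
  apply/asboolP => y /boxE yq; apply: dU; rewrite -ball_normE /=.
  apply: (@le_lt_trans _ _ (k.+1%:R^-1 + k.+1%:R^-1)); last by rewrite [ltRHS]splitr ltrD.
  apply: norm_le_coord => [|i]; first by rewrite addr_ge0.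
  rewrite !mxE (le_trans (ler_distD (ratr (q ord0 i)) _ _))//.
  by rewrite (distrC (ratr _)) lerD// ltW.
apply: countable_bigcupT_measurable => // p.
case: ifPn => // _; apply: measurable_rect => i; exact: measurable_itv.
Unshelve. all: by end_near. Qed.

Lemma continuous_measurable_rV (f : 'rV[R]_n -> R) :
  continuous f -> measurable_fun setT f.
Proof.
move=> /continuousP cf; apply: (measurability _ (RGenOpens.measurableE R)).
move=> _ [_ [a [b ->] <-]]; rewrite setTI; apply: open_measurable_rV.
exact/cf/interval_open.
Qed.

(** Rectangles are stable under intersection, which makes them suitable for
    comparing measures. *)
Lemma measurable_rV_rect :
  @measurable _ 'rV[R]_n =
  <<s [set X | exists2 A, (forall i, measurable (A i : set (measurableTypeR R))) & X = rect A] >>.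
Proof.
apply/seteqP; split; last first.
  apply: smallest_sub; first exact: sigma_algebra_measurable.
  by move=> _ [A mA ->]; exact: measurable_rect.
apply: smallest_sub; first exact: smallest_sigma_algebra.
move=> X; rewrite -bigcup_seq => -[i _ [Y mY <-]]; apply: sub_sigma_algebra.
exists (fun j => if j == i then Y else setT).
  by move=> j; case: ifPn => // _; exact: measurableT.
apply/seteqP; split => x /=; last by move=> /(_ i); rewrite eqxx; split.
by move=> [_ Yx] j; case: ifPn => // /eqP ->.
Qed.

End rectangles.

Section rV_cons_coordinates.
Context {R : realType} {n : nat}.
Implicit Types (p : measurableTypeR R * 'rV[R]_n).

Lemma rV_cons_head p : rV_cons p ord0 ord0 = p.1.
Proof. exact: (congr1 fst (rV_consK p)). Qed.

Lemma rV_cons_tail p i : rV_cons p ord0 (lift ord0 i) = p.2 ord0 i.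
Proof.
by have /(congr1 snd)/rowP/(_ i) := rV_consK p; rewrite mxE.
Qed.

End rV_cons_coordinates.

Section lebesgue_rV_unique.
Context {R : realType}.
Notation leb := (@lebesgue_measure R).

Lemma lebesgue_rV_rect n (A : 'I_n -> set R) :
  (forall i, measurable (A i : set (measurableTypeR R))) ->
  lebesgue_rV n (rect A) = (\prod_(i < n) leb (A i))%E.
Proof.
elim: n A => [|n IH] A mA.
  by rewrite big_ord0 /= diracE mem_set// => -[].
rewrite big_ord_recl -IH; last by move=> i; exact: mA.
rewrite /= /lebesgue_cons /pushforward -product_measure1E//; last first.
  by apply: measurable_rect => i; exact: mA.
congr (_ _); apply/seteqP; split => -[a v] /=.
  move=> Av; split => [|i].
    by have := Av ord0; rewrite rV_cons_head.
  by have := Av (lift ord0 i); rewrite rV_cons_tail.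
move=> [Aa Av] i; have [j ->|->] := unliftP ord0 i.
  by rewrite rV_cons_tail; exact: Av.
by rewrite rV_cons_head.
Qed.

Lemma lebesgue_rV_bounded_rect n (c : R) : (0 <= c) ->
  (lebesgue_rV n (rect (fun=> `](- c)%R, c%R[%classic)) < +oo)%E.
Proof.
move=> c0; rewrite lebesgue_rV_rect; last by move=> i; exact: measurable_itv.
rewrite ltey_eq; apply/orP; left; apply: prode_fin_num => i _.
by rewrite lebesgue_measure_itv /=; case: ifPn.
Qed.

(** The reason why dilations and permutations of the coordinates transform
    Lebesgue measure as they should: the claim has to be checked on rectangles
    only. *)
Lemma lebesgue_rV_unique n (mu : {measure set 'rV[R]_n -> \bar R}) :
  (forall A : 'I_n -> set R,
    (forall i, measurable (A i : set (measurableTypeR R))) ->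
    mu (rect A) = (\prod_(i < n) leb (A i))%E) ->
  forall X, measurable X -> lebesgue_rV n X = mu X.
Proof.
move=> muE; apply: (measure_unique _
    (fun k => rect (fun=> `](- k%:R), k%:R[%classic)) measurable_rV_rect).
- move=> _ _ [A mA ->] [B mB ->]; rewrite rectI; eexists; last reflexivity.
  by move=> i; exact: measurableI.
- by move=> k; eexists; last reflexivity; move=> i; exact: measurable_itv.
- rewrite -subTset => x _; exists (Num.truncn `|x|).+1 => // i /=.
  rewrite in_itv/= -ltr_norml (le_lt_trans (coord_le_norm x i))//.
  exact: truncnS_gt.
- by move=> _ [A mA ->]; rewrite muE//; exact: lebesgue_rV_rect.
- by move=> k; exact: lebesgue_rV_bounded_rect.
Qed.

End lebesgue_rV_unique.

Section Rintegral_transfer.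
Context d (T : measurableType d) (R : realType).
Variable mu : {measure set T -> \bar R}.

Lemma Rintegral_mscale (k : {nonneg R}) (D : set T) (f : T -> R) :
  measurable D -> mu.-integrable D (EFin \o f) ->
  \int[mscale k mu]_(x in D) f x = k%:num * \int[mu]_(x in D) f x.
Proof.
move=> mD intf.
have mf : measurable_fun D (EFin \o f) by exact: measurable_int intf.
rewrite /Rintegral -[k%:num]/(fine k%:num%:E) -fineM//; last first.
  by rewrite integrable_fin_num.
congr fine; rewrite integralE [in RHS]integralE !ge0_integral_mscale//.
- rewrite -muleBr//; apply: fin_num_adde_defl; rewrite fin_numN.
  exact: integrable_neg_fin_num.
- exact: measurable_funeneg.
- exact: measurable_funepos.
Qed.

End Rintegral_transfer.

Section change_of_variables.
Context {R : realType} {n : nat}.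
Notation leb := (lebesgue_rV n : {measure set 'rV[R]_n -> \bar R}).

Lemma Rintegral_change (phi : 'rV[R]_n -> 'rV[R]_n) (k : {nonneg R}) D (f : 'rV[R]_n -> R) :
  measurable_fun setT phi ->
  (forall X, measurable X -> leb (phi @^-1` X) = (k%:num%:E * leb X)%E) ->
  measurable D -> measurable_fun setT f ->
  leb.-integrable D (EFin \o f) ->
  leb.-integrable (phi @^-1` D) (EFin \o (f \o phi)) ->
  \int[leb]_(x in phi @^-1` D) f (phi x) = k%:num * \int[leb]_(x in D) f x.
Proof.
move=> mphi phiE mD mf intf intfphi.
rewrite -Rintegral_mscale// /Rintegral; congr fine.
rewrite -(@integral_pushforward _ _ _ _ _ _ mphi leb D (EFin \o f))//; last first.
  exact/measurable_EFinP.
by apply: eq_measure_integral => A mA _; exact: phiE.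
Qed.

End change_of_variables.

Section scaling.
Context {R : realType}.

Lemma lebesgue_measure_scale (c : R) (A : set R) : 0 < c ->
  measurable (A : set (measurableTypeR R)) ->
  lebesgue_measure (( *%R c) @^-1` A) = (c^-1%:E * lebesgue_measure A)%E.
Proof.
move=> c0 mA.
have mc : measurable_fun setT (( *%R c) : measurableTypeR R -> measurableTypeR R).
  exact: mulrl_measurable.
have c_ge0 : 0 <= c by exact: ltW.
suff -> : lebesgue_measure A = (c%:E * lebesgue_measure (( *%R c) @^-1` A))%E.
  by rewrite muleA -EFinM mulVf ?mul1e// gt_eqF.
pose mu : {measure set (measurableTypeR R) -> \bar R} :=
  mscale (NngNum c_ge0)
    (pushforward lebesgue_measure
      (( *%R c) : measurableTypeR R -> measurableTypeR R)).
rewrite -[RHS]/(mu mc A); apply: lebesgue_measure_unique => // _ [[a b]] _ <-.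
rewrite /mu /= /mscale /= /pushforward.
rewrite [X in (c%:E * lebesgue_measure X)%E](_ : _ = `](a / c), (b / c)]%classic); last first.
  by apply/seteqP; split => x /=; rewrite !in_itv/= ltr_pdivrMr// ler_pdivlMr// mulrC.
rewrite !lebesgue_measure_itv/= !lte_fin ltr_pM2r ?invr_gt0//.
case: ifPn => _; last by rewrite mule0.
by rewrite -!EFinB -mulrBl -EFinM mulrC divfK// gt_eqF.
Qed.

Lemma measurable_scale n (c : R) : measurable_fun setT (fun x : 'rV[R]_n => c *: x).
Proof.
apply: measurable_fun_rV => i.
under eq_fun do rewrite mxE.
by apply: measurable_funM => //; exact: measurable_coord.
Qed.

Lemma lebesgue_rV_scale n (c : R) (X : set 'rV[R]_n) : 0 < c -> measurable X ->
  lebesgue_rV n ((fun x => c *: x) @^-1` X) = ((c ^- n)%:E * lebesgue_rV n X)%E.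
Proof.
move=> c0 mX; have mc := @measurable_scale n c.
have c_ge0 : 0 <= c ^+ n by rewrite exprn_ge0// ltW.
suff -> : lebesgue_rV n X = ((c ^+ n)%:E * lebesgue_rV n ((fun x => c *: x)%R @^-1` X))%E.
  by rewrite muleA -EFinM mulVf ?mul1e// expf_neq0// gt_eqF.
pose mu : {measure set 'rV[R]_n -> \bar R} :=
  mscale (NngNum c_ge0) (pushforward (lebesgue_rV n) (fun x : 'rV[R]_n => c *: x)).
rewrite -[RHS]/(mu mc X); apply: lebesgue_rV_unique => // A mA.
rewrite /mu /= /mscale /= /pushforward.
rewrite [X in lebesgue_rV _ X](_ : _ = rect (fun i => ( *%R c) @^-1` A i)); last first.
  by apply/seteqP; split => x Ax i; have := Ax i; rewrite /= mxE.
rewrite lebesgue_rV_rect; last first.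
  by move=> i; rewrite -[X in measurable X]setTI; apply: mulrl_measurable => //; exact: mA.
rewrite (eq_bigr (fun i => (c^-1%:E * lebesgue_measure (A i))%E)); last first.
  by move=> i _; rewrite lebesgue_measure_scale//; exact: mA.
rewrite big_split /= muleA prodEFin -EFinM prodr_const card_ord exprVn mulfV ?mul1e//.
by rewrite expf_neq0// gt_eqF.
Qed.

End scaling.

Section permutation.
Context {R : realType} {n : nat}.

Lemma measurable_col_perm (s : {perm 'I_n}) :
  measurable_fun setT (col_perm s : 'rV[R]_n -> 'rV[R]_n).
Proof.
apply: measurable_fun_rV => i; under eq_fun do rewrite mxE.
exact: measurable_coord.
Qed.

Lemma lebesgue_rV_perm (s : {perm 'I_n}) (X : set 'rV[R]_n) : measurable X ->
  lebesgue_rV n (col_perm s @^-1` X) = lebesgue_rV n X.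
Proof.
move=> mX; have ms := measurable_col_perm s.
apply/esym.
pose mu : {measure set 'rV[R]_n -> \bar R} :=
  pushforward (lebesgue_rV n) (col_perm s : 'rV[R]_n -> 'rV[R]_n).
rewrite -[RHS]/(mu ms X); apply: lebesgue_rV_unique => // A mA.
rewrite /mu /= /pushforward.
rewrite [X in lebesgue_rV _ X](_ : _ = rect (fun i => A ((s^-1)%g i))); last first.
  apply/seteqP; split => x Ax i.
    by have := Ax ((s^-1)%g i); rewrite /= mxE permKV.
  by have := Ax (s i); rewrite /= mxE permK.
rewrite lebesgue_rV_rect//.
by rewrite [RHS](reindex_inj (@perm_inj _ (s^-1)%g)).
Qed.

End permutation.

(** * The Euclidean norm and integrals over balls *)

Section enorm_theory.
Context {R : realType} {n : nat}.
Implicit Types (x y : 'rV[R]_n) (r c : R).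

Lemma enorm_ge0 x : 0 <= enorm x.
Proof. exact: sqrtr_ge0. Qed.

Lemma enormE x : enorm x = Num.sqrt (rdot x x).
Proof. by []. Qed.

Lemma rdot_ge0 x : 0 <= rdot x x.
Proof. by apply: sumr_ge0 => i _; rewrite -expr2 sqr_ge0. Qed.

Lemma enorm_sqr x : enorm x ^+ 2 = rdot x x.
Proof. by rewrite enormE sqr_sqrtr// rdot_ge0. Qed.

Lemma enormZ c x : enorm (c *: x) = `|c| * enorm x.
Proof.
by rewrite !enormE rdotZl rdotZr mulrA -expr2 sqrtrM ?sqr_ge0// sqrtr_sqr.
Qed.

Lemma coord_le_enorm x i : `|x ord0 i| <= enorm x.
Proof.
rewrite -sqrtr_sqr ler_sqrt ?rdot_ge0// (bigD1 i)//= lerDl.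
by apply: sumr_ge0 => j _; exact: sqr_ge0.
Qed.

Lemma norm_le_enorm x : `|x| <= enorm x.
Proof. by apply: norm_le_coord => [|i]; rewrite ?enorm_ge0// coord_le_enorm. Qed.

Lemma enorm_eq0 x : (enorm x == 0) = (x == 0).
Proof.
apply/eqP/eqP => [x0|->]; last by rewrite -(scale0r 0) enormZ normr0 mul0r.
by apply/eqP; rewrite -normr_le0 -x0 norm_le_enorm.
Qed.

Lemma rdotxx_C1 : C1 (fun x => rdot x x).
Proof. by apply: C1_sum => i; apply: C1M; exact: C1_coord. Qed.

Lemma enorm_continuous : continuous (@enorm R n).
Proof.
move=> x; apply: (@continuous_comp _ _ _ (fun x => rdot x x) Num.sqrt).
  exact: C1_continuous rdotxx_C1 _.
exact: sqrt_continuous.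
Qed.

Lemma enorm_col_perm (s : {perm 'I_n}) x : enorm (col_perm s x) = enorm x.
Proof.
rewrite !enormE; congr Num.sqrt; rewrite /rdot.
by rewrite [RHS](reindex_inj (@perm_inj _ s)); apply: eq_bigr => i _; rewrite !mxE.
Qed.

Lemma radial_proj_diff r x : x != 0 -> `|x - radial_proj r x| <= `|enorm x - r|.
Proof.
move=> x0; rewrite /radial_proj -[X in X - _]scale1r -scalerBl.
have e0 : 0 < enorm x by rewrite lt0r enorm_eq0 x0 enorm_ge0.
rewrite (le_trans (norm_le_enorm _))// enormZ -{2}(gtr0_norm e0) -normrM.
by rewrite mulrBl mul1r divfK// gt_eqF.
Qed.

Lemma enorm_radial_proj r x : 0 <= r -> x != 0 -> enorm (radial_proj r x) = r.
Proof.
move=> r0 x0; rewrite enormZ ger0_norm; last by rewrite divr_ge0// enorm_ge0.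
by rewrite divfK// enorm_eq0.
Qed.

Lemma radial_proj0 r : radial_proj r (0 : 'rV[R]_n) = 0.
Proof. exact: scaler0. Qed.

Lemma enorm_radial_proj_le r x : 0 <= r -> enorm (radial_proj r x) <= r.
Proof.
move=> r0; have [->|x0] := eqVneq x 0; last by rewrite enorm_radial_proj.
by rewrite radial_proj0 (_ : enorm 0 = 0)//; apply/eqP; rewrite enorm_eq0.
Qed.

Lemma radial_projZ r c x : 0 < c -> radial_proj r (c *: x) = radial_proj r x.
Proof.
move=> c0; rewrite /radial_proj enormZ gtr0_norm// scalerA invfM.
by rewrite mulrA mulrAC divfK ?gt_eqF.
Qed.

Lemma le_eball r s : r <= s -> eball r `<=` (eball s : set 'rV[R]_n).
Proof. by move=> rs x /=; rewrite /eball /= => /lt_le_trans; exact. Qed.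

Lemma compact_closed_eball r : compact [set x : 'rV[R]_n | enorm x <= r].
Proof.
apply: bounded_closed_compact.
  exists r; split; first exact: num_real.
  by move=> s rs x /= xr; rewrite (le_trans (norm_le_enorm _))// (le_trans xr)// ltW.
rewrite [X in closed X](_ : _ = @enorm R n @^-1` `]-oo, r]%classic); last first.
  by apply/seteqP; split => x /=; rewrite in_itv.
by apply: closed_comp => [x _|]; [exact: enorm_continuous|exact: interval_closed].
Qed.

Lemma continuous_eball_bounded (f : 'rV[R]_n -> R) r : continuous f ->
  exists M, forall x, enorm x <= r -> `|f x| <= M.
Proof.
move=> cf.
have /compact_bounded[M [_ HM]] : compact (f @` [set x | enorm x <= r]).
  apply: continuous_compact; last exact: compact_closed_eball.
  by apply: continuous_subspaceT; exact: cf.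
exists (M + 1) => x xr; apply: (HM (M + 1)); first by rewrite ltrDl.
by exists x.
Qed.

(** Compactness is used as a statement about filters: a property that holds for
    all points near x and all small d, for every x in A, holds on the whole of A
    for all small d. *)
Lemma unif_continuous_compact (f : 'rV[R]_n -> R) (A : set 'rV[R]_n) (e : R) :
  compact A -> continuous f -> 0 < e ->
  exists2 d : R, 0 < d &
    forall x y, A x -> `|x - y| < d -> `|f x - f y| < e.
Proof.
move=> /compact_near_coveringP cA cf e0.
have e2 : 0 < e / 2 by rewrite divr_gt0.
have near_d : \forall d \near 0^'+,
    A `<=` [set x | forall y, `|x - y| < d -> `|f x - f y| < e].
  apply: (cA _ _ (fun (d : R) x => forall y, `|x - y| < d -> `|f x - f y| < e)) => x Ax.
  have /cvgrPdist_lt/(_ _ e2) := cf x; rewrite -nbhs_ballE => -[d /= d0 dP].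
  have d2 : 0 < d / 2 by rewrite divr_gt0.
  exists (ball x (d / 2), [set t | t < d / 2]) => /=.
    by split; [exact: nbhsx_ballx|exact: nbhs_right_lt].
  move=> [z t] /= [xz td] y zy.
  rewrite -ball_normE /= in xz.
  have xz' : `|f x - f z| < e / 2.
    apply: dP; rewrite -ball_normE /= (lt_trans xz)//.
    by rewrite ltr_pdivrMr// ltr_pMr// ltr1n.
  have xy' : `|f x - f y| < e / 2.
    apply: dP; rewrite -ball_normE /= (le_lt_trans (ler_distD z _ _))//.
    by rewrite [ltRHS]splitr ltrD// (lt_trans zy).
  rewrite (le_lt_trans (ler_distD (f x) _ _))// [ltRHS]splitr ltrD//.
  by rewrite distrC.
near (0 : R)^'+ => d.
have dA : A `<=` [set x | forall y, `|x - y| < d -> `|f x - f y| < e] by near: d.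
by exists d => // x y /dA; apply.
Unshelve. all: by end_near. Qed.

End enorm_theory.

Section ball_integrals.
Context {R : realType} {n : nat}.
Implicit Types (f g : 'rV[R]_n -> R) (x : 'rV[R]_n) (r s : R).
Notation leb := (lebesgue_rV n : {measure set 'rV[R]_n -> \bar R}).

Lemma eball_finite r : (leb (eball r) < +oo)%E.
Proof.
apply: (@le_lt_trans _ _ (leb (rect (fun=> `](- `|r|)%R, `|r|%R[%classic)))).
  apply: le_measure; rewrite ?inE; first exact: measurable_eball.
    by apply: measurable_rect => i; exact: measurable_itv.
  move=> x; rewrite /eball /= => xr i /=; rewrite in_itv/= -ltr_norml.
  by rewrite (le_lt_trans (coord_le_enorm x i))// (lt_le_trans xr)// ler_norm.
exact: lebesgue_rV_bounded_rect.
Qed.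

Lemma bounded_eball_integrable g r (M : R) :
  measurable_fun setT g -> (forall x, enorm x <= r -> `|g x| <= M) ->
  leb.-integrable (eball r) (EFin \o g).
Proof.
move=> mg gM; apply: measurable_bounded_integrable.
- exact: measurable_eball.
- exact: eball_finite.
- exact: measurable_funTS.
- exists M; split; first exact: num_real.
  by move=> N MN x /= /ltW xr; rewrite (le_trans (gM _ xr))// ltW.
Qed.

Lemma continuous_eball_integrable f r : continuous f ->
  leb.-integrable (eball r) (EFin \o f).
Proof.
move=> cf; have [M fM] := continuous_eball_bounded r cf.
by apply: (bounded_eball_integrable (M := M)) => //; exact: continuous_measurable_rV.
Qed.

Lemma measurable_comp_radial_proj f r : continuous f ->
  measurable_fun setT (f \o radial_proj r).
Proof.
move=> cf; apply: measurableT_comp; first exact: continuous_measurable_rV.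
exact: measurable_radial_proj.
Qed.

Lemma radial_proj_bounded f r : 0 <= r -> continuous f ->
  exists M, forall x, `|f (radial_proj r x)| <= M.
Proof.
move=> r0 cf; have [M fM] := continuous_eball_bounded r cf.
by exists M => x; apply: fM; exact: enorm_radial_proj_le.
Qed.

Lemma radial_proj_eball_integrable f r s : 0 <= r -> continuous f ->
  leb.-integrable (eball s) (EFin \o (f \o radial_proj r)).
Proof.
move=> r0 cf; have [M fM] := radial_proj_bounded r0 cf.
apply: (bounded_eball_integrable (M := M)); first exact: measurable_comp_radial_proj.
by move=> x _; exact: fM.
Qed.

(** The integrand is constant along rays, so that a dilation of the ball changes
    the integral by the Jacobian only. *)
Lemma radial_proj_integral_scale f r s : 0 < r -> 0 < s -> continuous f ->
  \int[leb]_(x in eball s) f (radial_proj r x) =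
  (s / r) ^+ n * \int[leb]_(x in eball r) f (radial_proj r x).
Proof.
move=> r0 s0 cf; have r_ge0 := ltW r0.
have c0 : 0 < s / r by rewrite divr_gt0.
have k0 : 0 <= (s / r) ^- n by rewrite invr_ge0 exprn_ge0// ltW.
have E : (fun x => (s / r) *: x) @^-1` eball s = eball r :> set 'rV[R]_n.
  apply/seteqP; split => x; rewrite /eball /= enormZ gtr0_norm// mulrAC ltr_pdivrMr//.
    by rewrite ltr_pM2l.
  by rewrite ltr_pM2l.
have fE : (f \o radial_proj r) \o (fun x => (s / r) *: x) = f \o radial_proj r.
  by apply/funext => x /=; rewrite radial_projZ.
have := @Rintegral_change R n (fun x => (s / r) *: x) (NngNum k0) (eball s)
  (f \o radial_proj r) (measurable_scale _) _ _ _ _ _.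
rewrite E fE => /(_ (fun X mX => lebesgue_rV_scale c0 mX) (measurable_eball s)
  (measurable_comp_radial_proj _ cf) (radial_proj_eball_integrable s r_ge0 cf)
  (radial_proj_eball_integrable r r_ge0 cf)) /= H.
rewrite [X in _ * X](_ : _ =
    \int[leb]_(x in eball r) f (radial_proj r ((s / r) *: x))); last first.
  by apply: eq_Rintegral => x _; rewrite radial_projZ.
by rewrite H mulrA mulfV ?mul1r// expf_neq0// gt_eqF.
Qed.

End ball_integrals.

(** * Polar coordinates *)

Section polar.
Context {R : realType} {n : nat}.
Implicit Types (f g : 'rV[R]_n -> R) (x : 'rV[R]_n) (r s : R).
Notation leb := (lebesgue_rV n : {measure set 'rV[R]_n -> \bar R}).

Definition ball_int f r : R := \int[leb]_(x in eball r) f x.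

(** The integral of f over the sphere of radius r, see [surface_integralE]: the
    surface measure of a piece of the sphere is n / r times the volume of the
    cone over it. *)
Definition sphere_int f r : R :=
  n%:R / r * \int[leb]_(x in eball r) f (radial_proj r x).

Let vol r : R := fine (leb (eball r)).

Let vol_scale r s : 0 < r -> 0 < s -> vol s = (s / r) ^+ n * vol r.
Proof.
move=> r0 s0.
have := @radial_proj_integral_scale R n (cst 1) r s r0 s0 (@cst_continuous _ _ _).
by rewrite !Rintegral_cst ?mul1r//; exact: measurable_eball.
Qed.

Let shell_estimate g (a b e : R) : a <= b ->
  leb.-integrable (eball b) (EFin \o g) ->
  (forall x, a <= enorm x < b -> `|g x| <= e) ->
  `|ball_int g b - ball_int g a| <= e * (vol b - vol a).
Proof.
move=> ab intg ge.
have mb := @measurable_eball R n b; have ma := @measurable_eball R n a.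
have mba : measurable (eball b `\` eball a : set 'rV[R]_n) by exact: measurableD.
have bE : eball b = eball a `|` (eball b `\` eball a) :> set 'rV[R]_n.
  by rewrite setDUK//; exact: le_eball.
have split h : leb.-integrable (eball b) (EFin \o h) ->
    ball_int h b - ball_int h a = \int[leb]_(x in eball b `\` eball a) h x.
  move=> inth; rewrite /ball_int {1}bE Rintegral_setU -?bE//.
    by rewrite addrAC subrr add0r.
  by apply/disj_setPS => x [ax [_ /(_ ax)]].
have inte : leb.-integrable (eball b) (EFin \o cst e).
  by apply: continuous_eball_integrable; exact: cst_continuous.
have -> : e * (vol b - vol a) = ball_int (cst e) b - ball_int (cst e) a.
  by rewrite /ball_int !Rintegral_cst// mulrBr.
rewrite !split//.
have sub : eball b `\` eball a `<=` (eball b : set 'rV[R]_n) by move=> x [].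
apply: le_trans (le_normr_Rintegral _ _) _ => //.
  exact: integrableS mb mba sub intg.
apply: le_Rintegral => //.
- exact/integrable_norm/(integrableS mb mba sub intg).
- exact: integrableS mb mba sub inte.
- move=> x []; rewrite /eball /= => xb /negP; rewrite -leNgt => xa.
  by apply: ge; rewrite xa.
Qed.

(** On a thin shell around the sphere of radius r, the function f is uniformly
    close to x |-> f (radial_proj r x).  The integral of the latter over the ball
    of radius s is an explicit multiple of s ^ n, whose derivative at r is the
    spherical integral; replacing f by it costs o(s - r), because the shell has
    volume O(s - r). *)
Lemma ball_int_derive f r : 0 < r -> continuous f ->
  is_derive r 1 (ball_int f) (sphere_int f r).
Proof.
move=> r0 cf; have r_ge0 := ltW r0.
pose m := \int[leb]_(x in eball r) f (radial_proj r x).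
pose pow (s : R) := (s / r) ^+ n.
have dpow : is_derive r 1 pow (n%:R / r).
  have -> : pow = ((fun s => r^-1 *: s) : R -> R) ^+ n.
    by apply/funext => s; rewrite /pow fctE /= mulrC.
  apply: is_derive_eq.
  by rewrite -[_ *: r]/(r^-1 * r) mulVf ?gt_eqF// expr1n mulr1 -[_ *: 1]/(r^-1 * 1) mulr1.
pose g x := f x - f (radial_proj r x).
(* the error made by replacing f with its values on the sphere of radius r *)
pose D s := ball_int f s - pow s * m.
have intF s := @radial_proj_eball_integrable R n f r s r_ge0 cf.
have intf s := @continuous_eball_integrable R n f s cf.
have DE s : 0 < s -> D s = ball_int g s.
  move=> s0; rewrite /D /m -radial_proj_integral_scale// /ball_int RintegralB//.
  exact: measurable_eball.
have intg s : leb.-integrable (eball s) (EFin \o g).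
  rewrite (_ : EFin \o g = ((EFin \o f) \- (EFin \o (f \o radial_proj r)))%E)//.
  by apply: integrableB; [exact: measurable_eball|exact: intf|exact: intF].
have close (e : R) : 0 < e -> exists2 d, 0 < d &
    forall s, `|s - r| < d -> `|D s - D r| <= e * vol r * `|pow s - pow r|.
  move=> e0.
  have [d d0 dP] := unif_continuous_compact (@compact_closed_eball R n (r + r)) cf e0.
  exists (Num.min d r) => [|s]; first by rewrite lt_min d0.
  rewrite lt_min => /andP[sd sr].
  have s0 : 0 < s.
    by move: sr; rewrite ltr_distl subrr => /andP[].
  have s2 : s < r + r by move: sr; rewrite ltr_distl => /andP[].
  have ge x : `|enorm x - r| <= `|s - r| -> 0 < enorm x -> enorm x <= r + r ->
      `|g x| <= e.
    move=> xr x0 x2; apply/ltW/dP => //; rewrite (le_lt_trans _ sd)// (le_trans _ xr)//.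
    by apply: radial_proj_diff; rewrite -enorm_eq0 gt_eqF.
  have pr : pow r = 1 by rewrite /pow divff ?expr1n// gt_eqF.
  have powE : vol r * (pow s - pow r) = vol s - vol r.
    by rewrite mulrBr pr mulr1 mulrC -vol_scale.
  rewrite !DE// -mulrA -[X in X * `|_|]ger0_norm; last by rewrite fine_ge0.
  rewrite -normrM powE.
  have [rs|sr'] := leP r s.
    apply: (le_trans (@shell_estimate g r s e rs (intg s) _)); last first.
      by rewrite ler_wpM2l ?ler_norm// ltW.
    move=> x /andP[rx xs]; apply: ge.
    - by rewrite !ger0_norm ?subr_ge0// lerD2r ltW.
    - exact: lt_le_trans rx.
    - by rewrite (le_trans (ltW xs))// ltW.
  rewrite distrC (distrC (vol s)).
  apply: (le_trans (@shell_estimate g s r e (ltW sr') (intg r) _)); last first.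
    by rewrite ler_wpM2l ?ler_norm// ltW.
  move=> x /andP[sx xr]; apply: ge.
  - rewrite distrC (distrC s) !ger0_norm ?subr_ge0 ?(ltW xr) ?(ltW sr')//.
    by rewrite lerD2l lerN2.
  - exact: lt_le_trans sx.
  - by rewrite (le_trans (ltW xr))// lerDl.
have dD : is_derive r 1 D 0.
  have L : (fun h : R => h^-1 *: ((D \o shift r) (h *: 1) - D r)) @ 0^' --> (0 : R).
    have [/cvg_ex[l Ql] _] := dpow.
    apply/cvgrPdist_le => e e0.
    have K0 : 0 < vol r * (`|l| + 1) + 1.
      by rewrite ltr_wpDl// mulr_ge0 ?fine_ge0// addr_ge0.
    have [d d0 dP] := close _ (divr_gt0 e0 K0).
    have Qb : \forall h \near 0^',
        `|h^-1 *: ((pow \o shift r) (h *: 1) - pow r)| <= `|l| + 1.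
      by apply: cvgr_norm_le Ql _ _; rewrite ltrDl.
    near=> h.
    have hQ : `|h^-1 *: ((pow \o shift r) (h *: 1) - pow r)| <= `|l| + 1 by near: h.
    have hd : `|h *: 1 + r - r| < d.
      rewrite addrK -[h *: 1]/(h * 1) mulr1.
      by near: h; exact: dnbhs0_lt.
    have := dP _ hd => /= hD.
    rewrite sub0r normrN normrZ.
    apply: (@le_trans _ _ (`|h^-1| * (e / (vol r * (`|l| + 1) + 1) * vol r *
      `|pow (h *: 1 + r) - pow r|))); first by rewrite ler_wpM2l.
    rewrite mulrCA -normrM.
    apply: (@le_trans _ _ (e / (vol r * (`|l| + 1) + 1) * vol r * (`|l| + 1))).
      rewrite ler_wpM2l//; apply: mulr_ge0; last exact: fine_ge0.
      by apply: divr_ge0; exact: ltW.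
    rewrite -mulrA mulrAC ler_pdivrMr// ler_wpM2l ?(ltW e0)// lerDl.
    exact: ler01.
  apply: DeriveDef; first by apply/cvg_ex; eexists; exact: L.
  exact/cvg_lim.
have -> : ball_int f = D + (fun s => m *: pow s).
  by apply/funext => s; rewrite fctE /D -[m *: _]/(m * _) (mulrC m) subrK.
apply: is_derive_eq.
by rewrite add0r -[_ *: _]/(_ * _) mulrC.
Unshelve. all: by end_near. Qed.

End polar.

Section Rintegral_mrestr.
Context d (T : measurableType d) (R : realType).
Variable mu : {measure set T -> \bar R}.

Lemma integral_mrestr (A D : set T) (mD : measurable D) (f : T -> \bar R) :
  measurable A -> (mrestr mu mD).-integrable A f ->
  (\int[mrestr mu mD]_(x in A) f x = \int[mu]_(x in A `&` D) f x)%E.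
Proof.
move=> mA intf.
rewrite (@negligible_integral _ _ _ _ A (~` D))//; last 2 first.
  exact: measurableC.
  by rewrite /= /mrestr setICl measure0.
rewrite setDE setCK; apply: eq_measure_integral => X mX XAD.
by rewrite /= /mrestr setIidl// => x /XAD[].
Qed.

End Rintegral_mrestr.

Section surface_integral.
Context {R : realType} {n : nat}.
Implicit Types (f : 'rV[R]_n -> R) (x : 'rV[R]_n) (r : R).
Notation leb := (lebesgue_rV n : {measure set 'rV[R]_n -> \bar R}).

Lemma measurable_esphere r : measurable (esphere r : set 'rV[R]_n).
Proof.
rewrite -[X in measurable X]setTI.
have -> : esphere r = enorm @^-1` [set r] :> set 'rV[R]_n by [].
by apply: measurable_enorm => //; exact: measurable_set1.
Qed.

Lemma set0_rect : [set 0] = rect (fun=> [set 0]) :> set 'rV[R]_n.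
Proof.
apply/seteqP; split => x /=; first by move=> -> i; rewrite /= mxE.
by move=> x0; apply/rowP => i; rewrite mxE; exact: x0.
Qed.

Lemma measurable_origin : measurable [set (0 : 'rV[R]_n)].
Proof. by rewrite set0_rect; apply: measurable_rect => i; exact: measurable_set1. Qed.

Lemma lebesgue_rV_origin : (0 < n)%N -> lebesgue_rV n [set (0 : 'rV[R]_n)] = 0%E.
Proof.
move=> n0; rewrite set0_rect lebesgue_rV_rect; last by move=> i; exact: measurable_set1.
rewrite (bigD1 (Ordinal n0))//= lebesgue_measure_set1 mul0e.
by [].
Qed.

(** The radial projection maps the ball without its centre to the sphere, and
    the centre is negligible since the dimension is positive. *)
Lemma surface_integralE f r : (0 < n)%N -> 0 < r -> continuous f ->
  \int[surface_measure r]_(x in esphere r) f x = sphere_int f r.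
Proof.
move=> n0 r0 cf; have r_ge0 := ltW r0.
have mE := measurable_esphere r.
have mf := continuous_measurable_rV cf.
have mp := @measurable_radial_proj R n r.
have mB := @measurable_eball R n r.
have mEp : measurable (radial_proj r @^-1` esphere r : set 'rV[R]_n).
  by rewrite -[X in measurable X]setTI; exact: mp.
have [M fM] := continuous_eball_bounded r cf.
have int1 : (mrestr leb mB).-integrable (radial_proj r @^-1` esphere r)
    (EFin \o (f \o radial_proj r)).
  apply: measurable_bounded_integrable => //.
  - rewrite /= /mrestr; apply: le_lt_trans (eball_finite r).
    by apply: le_measure; rewrite ?inE//; exact: measurableI.
  - by apply: measurable_funTS; exact: measurable_comp_radial_proj.
  - exists M; split; first exact: num_real.
    move=> N MN x _ /=; rewrite (le_trans (fM _ _))//; last exact: ltW.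
    exact: enorm_radial_proj_le.
have mfE : measurable_fun setT (EFin \o f) by exact/measurable_EFinP.
have int2 : (cone_volume r).-integrable (esphere r) (EFin \o f).
  exact: (@integrable_pushforward _ _ _ _ _ _ mp (mrestr leb mB) (esphere r) (EFin \o f)).
rewrite /surface_measure Rintegral_mscale// /sphere_int /= ger0_norm; last first.
  by rewrite divr_ge0.
congr (_ * _); rewrite /Rintegral; congr fine.
rewrite (@integral_pushforward _ _ _ _ _ _ mp (mrestr leb mB) (esphere r) (EFin \o f))//.
rewrite integral_mrestr//.
rewrite [RHS](@negligible_integral _ _ _ _ _ [set (0 : 'rV[R]_n)])//; last 3 first.
- exact: measurable_origin.
- exact: radial_proj_eball_integrable.
- exact: lebesgue_rV_origin.
congr integral; apply/seteqP; split => x /=.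
  move=> [xr Bx]; split => //= x0; move: xr; rewrite /esphere /= x0 radial_proj0.
  by move=> /eqP; rewrite (_ : enorm 0 = 0) ?lt_eqF//; apply/eqP; rewrite enorm_eq0.
move=> [Bx x0]; split => //; rewrite /esphere /= enorm_radial_proj//.
exact/eqP.
Qed.

End surface_integral.

(** * The divergence theorem on balls *)

Section slices.
Context {R : realType} {n : nat}.
Implicit Types (F : 'rV[R]_n.+1 -> R) (y : 'rV[R]_n) (r t : R).

Lemma rV_cons_line t y :
  rV_cons (t, y) = rV_cons (0, y) + t *: basis_vec ord0 :> 'rV[R]_n.+1.
Proof.
apply/rowP => i; rewrite [RHS]mxE.
rewrite [X in _ + X](_ : _ = t * (i == ord0)%:R); last by rewrite !mxE.
have [j ->|->] := unliftP ord0 i; first by rewrite !rV_cons_tail mulr0 addr0.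
by rewrite !rV_cons_head mulr1 add0r.
Qed.

Lemma enorm_rV_cons_sqr t y : enorm (rV_cons (t, y)) ^+ 2 = t ^+ 2 + enorm y ^+ 2.
Proof.
rewrite !enorm_sqr /rdot big_ord_recl rV_cons_head /= -expr2; congr (_ + _).
by apply: eq_bigr => i _; rewrite rV_cons_tail.
Qed.

Lemma is_derive_slice F t y : C1 F ->
  is_derive t 1 (fun s : R => F (rV_cons (s, y))) (partial ord0 F (rV_cons (t, y))).
Proof.
move=> F1; rewrite (rV_cons_line t) (_ : (fun s : R => F (rV_cons (s, y))) =
  (fun s => F (rV_cons (0, y) + s *: basis_vec ord0))).
  by apply: is_derive_line; exact: C1_derivable.
by apply/funext => s; rewrite rV_cons_line.
Qed.

Lemma continuous_slice (f : 'rV[R]_n.+1 -> R) y : continuous f ->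
  continuous (fun s : R => f (rV_cons (s, y))).
Proof.
move=> cf t; rewrite (_ : (fun s : R => f (rV_cons (s, y))) =
  f \o (fun s => rV_cons (0, y) + s *: basis_vec ord0)); last first.
  by apply/funext => s /=; rewrite rV_cons_line.
apply: continuous_comp; last exact: cf.
apply: (@cvgD _ _ _ _ _ (cst (rV_cons (0, y)))); first exact: cvg_cst.
by apply: cvgZr_tmp; exact: cvg_id.
Qed.

(** A line parallel to the first axis meets the ball in an open interval, empty
    or with end points on the sphere, where F vanishes: the fundamental theorem
    of calculus leaves nothing. *)
Lemma slice_integral F y r : C1 F -> 0 < r ->
  (forall x, enorm x = r -> F x = 0) ->
  (\int[lebesgue_measure]_(t in [set t : R | (enorm (rV_cons (t, y)) < r)%R])
     (partial ord0 F (rV_cons (t, y)))%:E)%E = 0%E.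
Proof.
move=> F1 r0 F0; have r_ge0 := ltW r0.
have ltE t : (enorm (rV_cons (t, y)) < r) = (t ^+ 2 < r ^+ 2 - enorm y ^+ 2).
  by rewrite -(ltr_pXn2r (n := 2)) ?nnegrE ?enorm_ge0// enorm_rV_cons_sqr ltrBrDr.
have [a0|a0] := ltP 0 (r ^+ 2 - enorm y ^+ 2); last first.
  rewrite [X in (\int[_]_(x in X) _)%E](_ : _ = set0) ?integral_set0//.
  rewrite -subset0 => t /=; rewrite ltE => /lt_le_trans/(_ a0).
  by rewrite ltNge sqr_ge0.
pose a := Num.sqrt (r ^+ 2 - enorm y ^+ 2).
have a_gt0 : 0 < a by rewrite sqrtr_gt0.
have aa : a ^+ 2 = r ^+ 2 - enorm y ^+ 2 by rewrite sqr_sqrtr// ltW.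
rewrite [X in (\int[_]_(x in X) _)%E](_ : _ = `](- a), a[%classic); last first.
  apply/seteqP; split => t /=; rewrite ltE -aa in_itv/= -ltr_norml -real_normK ?num_real//;
    by rewrite ltr_pXn2r// nnegrE// ltW.
have F_end t : t ^+ 2 = a ^+ 2 -> F (rV_cons (t, y)) = 0.
  move=> ta; apply: F0; apply/eqP; rewrite -(eqrXn2 (n := 2)) ?enorm_ge0//.
  by rewrite enorm_rV_cons_sqr ta aa subrK.
have cd : continuous (fun s : R => partial ord0 F (rV_cons (s, y))).
  by apply: continuous_slice; exact: C1_partial_continuous.
rewrite -(@integral_itv_bndoo _ _ _ _ true false); last first.
  by apply/measurable_EFinP/measurable_funTS; exact: continuous_measurable_fun.
have cF : continuous (fun s : R => F (rV_cons (s, y))).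
  by apply: continuous_slice; exact: C1_continuous.
rewrite (@continuous_FTC2 _ _ (fun s : R => F (rV_cons (s, y)))).
- by rewrite !F_end ?sqrrN// subee.
- by rewrite -subr_gt0 opprK addr_gt0.
- exact: continuous_subspaceT.
- split.
  + by move=> t _; have [] := is_derive_slice t y F1.
  + exact/cvg_at_right_filter/cF.
  + exact/cvg_at_left_filter/cF.
- by move=> t _; rewrite derive1E; have [_ ->] := is_derive_slice t y F1.
Qed.

End slices.

Section divergence_on_balls.
Context {R : realType}.

Lemma ball_int_partial_head n (F : 'rV[R]_n.+1 -> R) r : C1 F -> 0 < r ->
  (forall x, enorm x = r -> F x = 0) -> ball_int (partial ord0 F) r = 0.
Proof.
move=> F1 r0 F0.
have cf : continuous (partial ord0 F) by exact: C1_partial_continuous.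
have mf := continuous_measurable_rV cf.
have mB := @measurable_eball R n.+1 r.
have mc := @measurable_rV_cons R n.
have [M fM] := continuous_eball_bounded r cf.
pose nu := (@lebesgue_measure R \x lebesgue_rV n)%E.
pose P := @rV_cons R n @^-1` eball r.
have mP : measurable P by rewrite -[X in measurable X]setTI; exact: mc.
have mfE : measurable_fun setT (EFin \o partial ord0 F) by exact/measurable_EFinP.
have intP : nu.-integrable P (EFin \o (partial ord0 F \o @rV_cons R n)).
  apply: measurable_bounded_integrable => //.
  - exact: (@eball_finite R n.+1 r).
  - by apply: measurable_funTS; exact: measurableT_comp.
  - exists M; split; first exact: num_real.
    move=> N MN p /ltW pr /=; rewrite (le_trans (fM _ _))//; exact: ltW.
rewrite /ball_int /Rintegral /= /lebesgue_cons.
rewrite (@integral_pushforward _ _ _ _ _ _ mc nu (eball r) (EFin \o partial ord0 F))//.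
rewrite integral_mkcond -integral21_prod_meas1.
  rewrite (_ : (\int[_]_x _)%E = 0%E)//.
  apply: integral0_eq => y _; rewrite /fubini_G.
  transitivity (\int[lebesgue_measure]_(t in [set t : R | (enorm (rV_cons (t, y)) < r)%R])
     (partial ord0 F (rV_cons (t, y)))%:E)%E; last exact: slice_integral.
  by rewrite [RHS]integral_mkcond.
by apply/integrable_restrict => //; rewrite setTI.
Qed.

Lemma col_permB n (s : {perm 'I_n}) (x y : 'rV[R]_n) :
  col_perm s (x - y) = col_perm s x - col_perm s y.
Proof. by apply/rowP => i; rewrite !mxE. Qed.

Lemma col_perm_continuous n (s : {perm 'I_n}) :
  continuous (col_perm s : 'rV[R]_n -> 'rV[R]_n).
Proof.
move=> x; apply/(@cvgrPdist_le R 'rV[R]_n 'rV[R]_n (nbhs x)) => e e0.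
near=> y.
rewrite -col_permB; apply: norm_le_coord => [|i]; first exact: ltW.
rewrite mxE; apply: le_trans (coord_le_norm _ _) _.
by near: y; exact: (@cvgr_dist_le R 'rV[R]_n 'rV[R]_n (nbhs x) _ id x).
Unshelve. all: by end_near. Qed.

Lemma partial_col_perm n (s : {perm 'I_n}) (F : 'rV[R]_n -> R) i x : C1 F ->
  is_derive x (basis_vec i) (F \o col_perm s) (partial ((s^-1)%g i) F (col_perm s x)).
Proof.
move=> F1; have [dF DF] := C1_is_partial ((s^-1)%g i) (col_perm s x) F1.
have E h : F (h *: basis_vec ((s^-1)%g i) + col_perm s x) =
    ((F \o col_perm s) \o shift x) (h *: basis_vec i).
  congr F; apply/rowP => j; rewrite !mxE.
  by rewrite -(inj_eq (@perm_inj _ s)) permKV.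
apply: DeriveDef.
  move: dF; rewrite /derivable /=; under eq_fun do rewrite E; exact.
by rewrite -DF /partial /derive /=; under [in RHS]eq_fun do rewrite E.
Qed.

Lemma C1_col_perm n (s : {perm 'I_n}) (F : 'rV[R]_n -> R) :
  C1 F -> C1 (F \o col_perm s).
Proof.
move=> F1.
apply: (@C1_of_is_derive _ _ _ (fun i x => partial ((s^-1)%g i) F (col_perm s x))) => i x.
  exact: partial_col_perm.
apply: (@continuous_comp _ _ _ (col_perm s : 'rV[R]_n -> _) (partial _ F)).
  exact: col_perm_continuous.
exact: C1_partial_continuous.
Qed.

Lemma ball_int_col_perm n (s : {perm 'I_n}) (f : 'rV[R]_n -> R) r : continuous f ->
  ball_int (f \o col_perm s) r = ball_int f r.
Proof.
move=> cf.
have k0 : 0 <= (1 : R) by [].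
have E : col_perm s @^-1` eball r = eball r :> set 'rV[R]_n.
  by apply/seteqP; split => x; rewrite /eball /= enorm_col_perm.
have cfs : continuous (f \o col_perm s).
  by move=> x; apply: continuous_comp; [exact: col_perm_continuous|exact: cf].
have := @Rintegral_change R n (col_perm s) (NngNum k0) (eball r) f
  (measurable_col_perm s) _ (measurable_eball r) (continuous_measurable_rV cf)
  (continuous_eball_integrable r cf).
rewrite E mul1r; apply; last exact: continuous_eball_integrable.
by move=> X mX; rewrite [RHS]mul1e; exact: lebesgue_rV_perm.
Qed.

Lemma ball_int_partial n (j : 'I_n) (F : 'rV[R]_n -> R) r : C1 F -> 0 < r ->
  (forall x, enorm x = r -> F x = 0) -> ball_int (partial j F) r = 0.
Proof.
case: n j F => [[]//|n] j F F1 r0 F0; pose s := tperm ord0 j.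
rewrite -(ball_int_col_perm s); last exact: C1_partial_continuous.
have -> : partial j F \o col_perm s = partial ord0 (F \o col_perm s).
  apply/esym/partialE => x; have := partial_col_perm s ord0 x F1.
  by rewrite /s tpermV tpermL.
apply: ball_int_partial_head => // [|x xr]; first exact: C1_col_perm.
by apply: F0; rewrite enorm_col_perm.
Qed.

End divergence_on_balls.

Section ball_int_linear.
Context {R : realType} {n : nat}.
Implicit Types (f g : 'rV[R]_n -> R) (r : R).

Lemma eq_ball_int f g r : (forall x, enorm x < r -> f x = g x) ->
  ball_int f r = ball_int g r.
Proof. by move=> fg; apply: eq_Rintegral => x /set_mem; exact: fg. Qed.

Lemma ball_intD f g r : continuous f -> continuous g ->
  ball_int (fun x => f x + g x) r = ball_int f r + ball_int g r.
Proof.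
by move=> cf cg; apply: RintegralD; [exact: measurable_eball|
  exact: continuous_eball_integrable|exact: continuous_eball_integrable].
Qed.

Lemma ball_intB f g r : continuous f -> continuous g ->
  ball_int (fun x => f x - g x) r = ball_int f r - ball_int g r.
Proof.
by move=> cf cg; apply: RintegralB; [exact: measurable_eball|
  exact: continuous_eball_integrable|exact: continuous_eball_integrable].
Qed.

Lemma ball_intZ c f r : continuous f ->
  ball_int (fun x => c * f x) r = c * ball_int f r.
Proof.
by move=> cf; apply: RintegralZl; [exact: measurable_eball|
  exact: continuous_eball_integrable].
Qed.

Lemma ball_int_sum m (f : 'I_m -> 'rV[R]_n -> R) r : (forall k, continuous (f k)) ->
  ball_int (fun x => \sum_k f k x) r = \sum_k ball_int (f k) r.
Proof.
elim: m f => [|m IH] f cf.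
  rewrite big_ord0 (@eq_ball_int _ (fun=> 0 * 0)).
    by rewrite ball_intZ ?mul0r//; exact: cst_continuous.
  by move=> x _; rewrite big_ord0 mul0r.
rewrite big_ord_recl -IH//.
rewrite -ball_intD//; last exact: continuous_sumr.
by apply: eq_ball_int => x _; rewrite big_ord_recl.
Qed.

Lemma le_ball_int f g r : continuous f -> continuous g ->
  (forall x, f x <= g x) -> ball_int f r <= ball_int g r.
Proof.
by move=> cf cg fg; apply: le_Rintegral => [||| x _]; [exact: measurable_eball|
  exact: continuous_eball_integrable|exact: continuous_eball_integrable|exact: fg].
Qed.

End ball_int_linear.

Section divergence_theorem.
Context {R : realType} {n : nat}.
Implicit Types (W : 'rV[R]_n -> 'rV[R]_n) (r : R).

Lemma partial_rdotxx j : partial j (fun x : 'rV[R]_n => rdot x x) =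
  (fun x => 2 * x ord0 j).
Proof.
rewrite /rdot partial_sum; last by move=> i; apply: C1M; exact: C1_coord.
apply/funext => x; rewrite (bigD1 j)//= big1 => [|i ij].
  rewrite partialM; try exact: C1_coord.
  by rewrite partial_coord eqxx mulr1 addr0 mulrDl mul1r.
rewrite partialM; try exact: C1_coord.
by rewrite partial_coord eq_sym (negbTE ij) !mulr0 addr0.
Qed.

Definition C1_field W := forall j, C1 (fun x => W x ord0 j).

Lemma divergence_continuous W : C1_field W -> continuous (divergence W).
Proof.
by move=> W1; apply: continuous_sumr => j; exact: C1_partial_continuous.
Qed.

Lemma C1_rdot_field W : C1_field W -> C1 (fun x => rdot x (W x)).
Proof. by move=> W1; apply: C1_sum => j; apply: C1M => //; exact: C1_coord. Qed.

(** The factor r ^ 2 - |x| ^ 2 vanishes on the sphere, so that integrating by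
    parts against it produces no boundary term; its gradient is - 2 x. *)
Lemma weighted_divergence W r : 0 < r -> C1_field W ->
  ball_int (fun x => (r ^+ 2 - rdot x x) * divergence W x) r =
  2 * ball_int (fun x => rdot x (W x)) r.
Proof.
move=> r0 W1.
pose phi (x : 'rV[R]_n) := r ^+ 2 - rdot x x.
have phi1 : C1 phi by apply: C1D; [exact: C1_cst|apply: C1N; exact: rdotxx_C1].
have dphi j : partial j phi = (fun x => - (2 * x ord0 j)).
  rewrite partialD; [|exact: C1_cst|by apply: C1N; exact: rdotxx_C1].
  rewrite partial_cst partialN; last exact: rdotxx_C1.
  by apply/funext => x; rewrite partial_rdotxx add0r.
pose F j (x : 'rV[R]_n) := phi x * W x ord0 j.
have F1 j : C1 (F j) by exact: C1M.
have dF j : ball_int (partial j (F j)) r = 0.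
  apply: ball_int_partial => // x xr.
  by rewrite /F /phi -enorm_sqr xr subrr mul0r.
have cphidiv : continuous (fun x => phi x * divergence W x).
  by apply: continuous_mulr; [exact: C1_continuous|exact: divergence_continuous].
have cW : continuous (fun x => rdot x (W x)) by apply: C1_continuous; exact: C1_rdot_field.
have := ball_int_sum r (fun j => C1_partial_continuous (i := j) (F1 j)).
rewrite [RHS]big1// => /esym; rewrite -ball_intZ//.
rewrite (@eq_ball_int _ _ _ (fun x => phi x * divergence W x - 2 * rdot x (W x))).
  rewrite ball_intB//; last by apply: continuous_mulr => //; exact: cst_continuous.
  by move=> /eqP; rewrite eq_sym subr_eq0 => /eqP.
move=> x _; rewrite /divergence /rdot !mulr_sumr -sumrB; apply: eq_bigr => j _.
by rewrite partialM// dphi mulrN mulrA (mulrC (W x ord0 j)).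
Qed.

Lemma sphere_int_rdotxx (g : 'rV[R]_n -> R) r : (0 < n)%N -> 0 < r -> continuous g ->
  sphere_int (fun x => rdot x x * g x) r = r ^+ 2 * sphere_int g r.
Proof.
move=> n0 r0 cg.
have cq : continuous (fun x : 'rV[R]_n => rdot x x * g x).
  by apply: continuous_mulr => //; apply: C1_continuous; exact: rdotxx_C1.
rewrite -!surface_integralE//.
have -> : \int[surface_measure r]_(x in esphere r) (rdot x x * g x) =
   \int[surface_measure r]_(x in esphere r) (r ^+ 2 * g x).
  by apply: eq_Rintegral => x /set_mem xr; rewrite -enorm_sqr xr.
rewrite !surface_integralE//; last by apply: continuous_mulr => //; exact: cst_continuous.
rewrite /sphere_int mulrCA; congr (_ * _).
rewrite RintegralZl//; first exact: measurable_eball.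
by apply: radial_proj_eball_integrable => //; exact: ltW.
Qed.

Let is_derive_sqrM (A B : R -> R) (a b r : R) :
  is_derive r 1 A a -> is_derive r 1 B b ->
  is_derive r 1 (fun s => s ^+ 2 * A s - B s) (r ^+ 2 * a + A r * (2 * r) - b).
Proof.
move=> dA dB; apply: is_deriveB; apply: is_deriveM.
have := is_deriveX 2 (is_derive_id r (1 : R)).
by rewrite expr1 -[_ *: 1]/(_ * 1) mulr1.
Qed.

Let is_derive_scale (A : R -> R) (a r : R) :
  is_derive r 1 A a -> is_derive r 1 (fun s => 2 * A s) (2 * a).
Proof. exact: is_deriveZ. Qed.

(** The weighted identity holds for every radius, and both sides can be
    differentiated in the radius by polar coordinates.  The boundary
    contributions of the left-hand side cancel, as the weight vanishes there. *)
Lemma divergence_theorem W r : (0 < n)%N -> 0 < r -> C1_field W ->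
  r * ball_int (divergence W) r = sphere_int (fun x => rdot x (W x)) r.
Proof.
move=> n0 r0 W1; pose g := divergence W.
have cg : continuous g by exact: divergence_continuous.
have cN : continuous (fun x => rdot x (W x)) by apply: C1_continuous; exact: C1_rdot_field.
have cq : continuous (fun x : 'rV[R]_n => rdot x x * g x).
  by apply: continuous_mulr => //; apply: C1_continuous; exact: rdotxx_C1.
(* on the sphere the weight |x| ^ 2 is the constant r ^ 2 *)
have Sq := sphere_int_rdotxx n0 r0 cg.
pose P s := s ^+ 2 * ball_int g s - ball_int (fun x => rdot x x * g x) s.
have PE s : 0 < s -> 2 * ball_int (fun x => rdot x (W x)) s = P s.
  move=> s0; rewrite -weighted_divergence//.
  rewrite (@eq_ball_int _ _ _ (fun x => s ^+ 2 * g x - rdot x x * g x)).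
    rewrite ball_intB//; last by apply: continuous_mulr => //; exact: cst_continuous.
    by rewrite ball_intZ.
  by move=> x _; rewrite mulrBl.
have dg := ball_int_derive r0 cg.
have dq := ball_int_derive r0 cq.
have dN := ball_int_derive r0 cN.
have [_ E1] := is_derive_sqrM dg dq.
have [_ E2] : is_derive r 1 P (2 * sphere_int (fun x => rdot x (W x)) r).
  have := is_derive_scale dN.
  apply: near_eq_is_derive; near=> s; apply: PE.
  by near: s; exact: lt_nbhsr.
move: E2; rewrite E1 Sq addrAC subrr add0r mulrCA => E2.
have two0 : (2 : R) != 0 by rewrite pnatr_eq0.
by apply: (mulfI two0); rewrite -E2 (mulrC r).
Unshelve. all: by end_near. Qed.

End divergence_theorem.

(** * Chain rules *)

Section chain_rule.
Context {R : realType} {V W : normedModType R}.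

(** Only the derivative of u in the direction v is available, which is all that
    the restriction of g \o u to a line requires. *)
Lemma is_derive_comp (g : W -> R) (u : V -> W) (x v : V) (du : W) :
  differentiable g (u x) -> is_derive x v u du ->
  is_derive x v (g \o u) ('d g (u x) du).
Proof.
move=> dg [du_ex duE].
pose gamma (h : R) := u (h *: v + x).
have gamma0 : gamma 0 = u x by rewrite /gamma scale0r add0r.
have shift0 T (f : R -> T) (h : R) : (f \o shift 0) (h *: 1) = f h.
  by rewrite /= addr0 -[h *: 1]/(h * 1) mulr1.
have dgamma : is_derive (0 : R) (1 : R) gamma du.
  apply: DeriveDef; first exact: (derivable1P u x v).1.
  rewrite -duE /derive.
  under eq_fun do rewrite shift0 gamma0; by [].
have diffgamma : differentiable gamma (0 : R).
  by apply/derivable1_diffP; have [] := dgamma.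
have dgg : differentiable g (gamma 0) by rewrite gamma0.
have diffcomp : differentiable (g \o gamma) (0 : R) by exact: differentiable_comp.
have dE : 'D_v (g \o u) x = 'D_1 (g \o gamma) (0 : R).
  rewrite /derive.
  under [in RHS]eq_fun do rewrite (shift0 _ (g \o gamma)) /= gamma0; by [].
apply: DeriveDef.
  by apply: (derivable1P (g \o u) x v).2; apply/derivable1_diffP; exact: diffcomp.
rewrite dE deriveE// diff_comp// /= gamma0; congr ('d g _ _).
by have [_ <-] := dgamma; rewrite deriveE.
Qed.

End chain_rule.

Section chain_rule_instances.
Context {R : realType}.

Lemma is_derive_comp_real (V : normedModType R) (Phi : R -> R) (s : V -> R) x v ds :
  derivable Phi (s x) 1 -> is_derive x v s ds ->
  is_derive x v (Phi \o s) (Phi^`()%classic (s x) * ds).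
Proof.
move=> dPhi dss.
have dP : differentiable Phi (s x) by apply/derivable1_diffP.
have E : 'd Phi (s x) ds = Phi^`()%classic (s x) * ds.
  by have /(congr1 (@^~ ds)) -> := deriv1E dPhi; exact: mulrC.
exact: is_derive_eq (is_derive_comp dP dss) E.
Qed.

Lemma is_derive_comp_rV (V : normedModType R) m (g : 'rV[R]_m -> R)
    (u : V -> 'rV[R]_m) x v (du : 'I_m -> R) :
  C1 g -> (forall i, is_derive x v (fun y => u y ord0 i) (du i)) ->
  is_derive x v (g \o u) (\sum_i partial i g (u x) * du i).
Proof.
move=> g1 dui.
have du_ex : derivable u x v.
  apply/derivable_mxP => i j; rewrite ord1.
  by have [] := dui j.
have duu : is_derive x v u (\row_i du i).
  apply: DeriveDef => //; rewrite derive_mx//; apply/rowP => j; rewrite !mxE.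
  by have [_] := dui j.
have := is_derive_comp (C1_differentiable (u x) g1) duu.
have [_ ->] := C1_diff (u x) g1.
congr is_derive; rewrite /rdot; apply: eq_bigr => i _; by rewrite !mxE.
Qed.

(** This gives the derivative of Phi (|grad f| ^ 2) at the critical points of f,
    where Phi itself need not be differentiable. *)
Lemma is_derive_squeeze (V : normedModType R) (E B : V -> R) x v :
  (forall y, 0 <= E y <= B y) -> B x = 0 -> is_derive x v B 0 ->
  is_derive x v E 0.
Proof.
move=> EB Bx0 [dB DB].
have Ex0 : E x = 0 by apply/eqP; rewrite eq_le -{1}Bx0 andbC; have := EB x.
have L : (fun h : R => h^-1 *: ((E \o shift x) (h *: v) - E x)) @ 0^' --> (0 : R).
  have BL : (fun h : R => h^-1 *: ((B \o shift x) (h *: v) - B x)) @ 0^' --> 'D_v B x.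
    exact: dB.
  move: BL; rewrite DB => /cvgrPdist_le BL.
  apply/cvgrPdist_le => e e0; apply: filterS (BL _ e0) => h.
  rewrite !sub0r !normrN Ex0 Bx0 !subr0 !normrZ; apply: le_trans.
  rewrite ler_wpM2l//; have /andP[E0 EleB] := EB (h *: v + x).
  by rewrite /= !ger0_norm// (le_trans E0).
apply: DeriveDef; first by apply/cvg_ex; eexists; exact: L.
exact/cvg_lim.
Qed.

End chain_rule_instances.

(** * The nonlinearity *)

Section Phi_theory.
Context {R : realType}.
Variable Phi : R -> R.
Hypothesis Phi_C2 : C2_Rplus Phi.
Hypothesis Phi0 : Phi 0 = 0.
Hypothesis Phi_gt0 : forall s : R, 0 < s -> 0 < Phi s.
Hypothesis dPhi_gt0 : forall s : R, 0 < s -> 0 < Phi^`()%classic s.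
Hypothesis Phi_elliptic :
  forall s : R, 0 < s -> 0 < Phi^`()%classic s + 2 * s * Phi^`(2)%classic s.

(** By ellipticity t |-> 2 t Phi'(t) - Phi(t) is increasing.  Its value at t is
    larger than - Phi(t), which tends to 0 with t, hence it is nonnegative. *)
Lemma Phi_le s : 0 < s -> Phi s <= 2 * s * Phi^`()%classic s.
Proof.
move=> s0; have [cPhi dPhi ddPhi _] := Phi_C2.
pose K (t : R) := 2 * t * Phi^`()%classic t - Phi t.
pose dK (t : R) : R := Phi^`()%classic t + 2 * t * Phi^`(2)%classic t.
have KP (t : R) : 0 < t -> is_derive t 1 K (dK t).
  move=> t0.
  have d1 : is_derive t 1 Phi (Phi^`()%classic t).
    by apply: DeriveDef; [exact: dPhi|rewrite derive1E].
  have d2 : is_derive t 1 Phi^`()%classic (Phi^`(2)%classic t).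
    by apply: DeriveDef; [exact: ddPhi|rewrite -derive1E].
  have d3 : is_derive t 1 (fun t : R => 2 * t) 2.
    by have := is_deriveZ 2 (is_derive_id t (1 : R)); rewrite -[_ *: 1]/(_ * 1) mulr1.
  have := is_deriveB (is_deriveM d3 d2) d1.
  congr is_derive; rewrite /dK -![_ *: _]/(_ * _).
  by rewrite mulrC (mulrC (Phi^`()%classic t)) mulrDl mul1r; ring.
have Kt (t : R) : 0 < t -> t < s -> - Phi t <= K s.
  move=> t0 ts.
  have Kts : {within `[t, s], continuous K}.
    apply: derivable_within_continuous => z; rewrite in_itv/= => /andP[tz _].
    by have [] := KP z (lt_le_trans t0 tz).
  have KPt z : z \in `]t, s[ -> is_derive z 1 K (dK z).
    by rewrite in_itv/= => /andP[tz _]; apply: KP; exact: lt_trans tz.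
  have [z] := MVT ts KPt Kts.
  rewrite in_itv/= => /andP[tz zs] KE.
  have : 0 <= K s - K t.
    rewrite KE mulr_ge0//; last by rewrite subr_ge0 ltW.
    by rewrite ltW// Phi_elliptic// (lt_trans t0).
  rewrite subr_ge0; apply: le_trans.
  by rewrite lerDr !mulr_ge0// ltW// dPhi_gt0.
rewrite -subr_ge0 -/(K s) leNgt; apply/negP => Ks.
have Phi_cvg : Phi t @[t --> 0^'+] --> 0.
  by have /continuous_within_itvcyP[_] := cPhi; rewrite Phi0.
have Phi_small : \forall t \near 0^'+, Phi t < - K s.
  by apply: (cvgr_lt _ Phi_cvg); rewrite oppr_gt0.
near (0 : R)^'+ => t.
have t0 : 0 < t by [].
have ts : t < s by near: t; exact: nbhs_right_lt.
have : Phi t < - K s by near: t.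
by rewrite ltNge => /negP; apply; rewrite lerNl Kt.
Unshelve. all: by end_near. Qed.

Lemma alpha_bound (alpha : R) s : (alpha_star Phi <= alpha%:E)%E -> 0 < s ->
  2 * s * Phi^`()%classic s <= alpha * Phi s.
Proof.
move=> aa s0; rewrite -ler_pdivrMr ?Phi_gt0// -lee_fin (le_trans _ aa)//.
by apply: ereal_sup_ubound; exists s.
Qed.

Lemma alpha_gt0 (alpha : R) : (alpha_star Phi <= alpha%:E)%E -> 0 < alpha.
Proof.
move=> /alpha_bound/(_ ltr01) h.
have : 0 < alpha * Phi 1 by rewrite (lt_le_trans _ h)// mulr1 mulr_gt0// dPhi_gt0.
by rewrite pmulr_lgt0// Phi_gt0.
Qed.

End Phi_theory.

(** * Energy density and dilations *)

Section energy_density.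
Context {R : realType} {n : nat}.
Variable Phi : R -> R.
Hypothesis Phi_C2 : C2_Rplus Phi.
Hypothesis Phi0 : Phi 0 = 0.
Hypothesis Phi_gt0 : forall s : R, 0 < s -> 0 < Phi s.
Hypothesis dPhi_gt0 : forall s : R, 0 < s -> 0 < Phi^`()%classic s.
Hypothesis Phi_elliptic :
  forall s : R, 0 < s -> 0 < Phi^`()%classic s + 2 * s * Phi^`(2)%classic s.
Variable f : 'rV[R]_n -> R.
Hypothesis f_C2 : C2 f.
Hypothesis flux_C1 : C1_field (flux Phi f).

Definition energy (x : 'rV[R]_n) : R := Phi (enorm (gradient f x) ^+ 2).

(** The derivative of f along the Euler vector field x, the generator of
    dilations. *)
Definition euler (x : 'rV[R]_n) : R := rdot x (gradient f x).

Let df_C1 j : C1 (partial j f) := f_C2.2 j.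

Lemma flux_coord x j :
  flux Phi f x ord0 j = Phi^`()%classic (enorm (gradient f x) ^+ 2) * partial j f x.
Proof. by rewrite !mxE. Qed.

Lemma rdot_flux x y : rdot (flux Phi f x) y =
  Phi^`()%classic (enorm (gradient f x) ^+ 2) * rdot (gradient f x) y.
Proof. exact: rdotZl. Qed.

Lemma rdot_gradient x y : rdot (gradient f x) y = \sum_j partial j f x * y ord0 j.
Proof. by apply: eq_bigr => j _; rewrite mxE. Qed.

Lemma enorm_gradient_sqr x :
  enorm (gradient f x) ^+ 2 = \sum_j partial j f x * partial j f x.
Proof. by rewrite enorm_sqr rdot_gradient; apply: eq_bigr => j _; rewrite mxE. Qed.

Let sqgrad x := \sum_j partial j f x * partial j f x.

Let sqgrad_C1 : C1 sqgrad.
Proof. by apply: C1_sum => j; exact: (C1M (df_C1 j) (df_C1 j)). Qed.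

Let partial_sqgrad k x :
  partial k sqgrad x = 2 * \sum_j partial j f x * partial k (partial j f) x.
Proof.
rewrite /sqgrad partial_sum; last by move=> j; exact: (C1M (df_C1 j) (df_C1 j)).
rewrite mulr_sumr; apply: eq_bigr => j _.
by rewrite (partialM k (df_C1 j) (df_C1 j)) mulrDl mul1r.
Qed.

Lemma energy_bounds x :
  0 <= energy x <= 2 * rdot (flux Phi f x) (gradient f x).
Proof.
rewrite rdot_flux -enorm_sqr /energy.
have : 0 <= enorm (gradient f x) ^+ 2 by exact: sqr_ge0.
move: (_ ^+ 2) => s; rewrite le_eqVlt => /predU1P[<-|s0].
  by rewrite Phi0 !mulr0 lexx.
by rewrite ltW ?Phi_gt0//= mulrCA mulrC (Phi_le Phi_C2).
Qed.

Let fluxM_C1 j : C1 (fun x => flux Phi f x ord0 j * partial j f x).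
Proof. exact: (C1M (flux_C1 j) (df_C1 j)). Qed.

Let rdot_flux_gradient x :
  rdot (flux Phi f x) (gradient f x) = \sum_j flux Phi f x ord0 j * partial j f x.
Proof. by apply: eq_bigr => j _; rewrite [X in _ * X]mxE. Qed.

(** Away from the critical points of f this is the chain rule.  At a critical
    point, the energy is squeezed between 0 and 2 flux . grad f; this product of
    two C^1 functions which both vanish there has a zero derivative. *)
Lemma energy_is_derive k x : is_derive x (basis_vec k) energy
  (2 * \sum_j flux Phi f x ord0 j * partial k (partial j f) x).
Proof.
have energyE : energy = Phi \o sqgrad.
  by apply/funext => y; rewrite /energy enorm_gradient_sqr.
have [s0|s0] := eqVneq (enorm (gradient f x) ^+ 2) 0.
  have grad0 : gradient f x = 0.
    by apply/eqP; rewrite -enorm_eq0 -sqrf_eq0 s0.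
  have pf0 j : partial j f x = 0.
    by have := congr1 (fun v : 'rV[R]_n => v ord0 j) grad0; rewrite !mxE.
  have flux0 j : flux Phi f x ord0 j = 0 by rewrite flux_coord pf0 mulr0.
  have -> : 2 * \sum_j flux Phi f x ord0 j * partial k (partial j f) x = 0.
    by rewrite big1 ?mulr0// => j _; rewrite flux0 mul0r.
  apply: (is_derive_squeeze (B := fun y => 2 * \sum_j flux Phi f y ord0 j * partial j f y)).
  - by move=> y; rewrite -rdot_flux_gradient; exact: energy_bounds.
  - by rewrite big1 ?mulr0// => j _; rewrite flux0 mul0r.
  - apply: is_derive_eq (C1_is_partial k x (C1Z 2 (C1_sum fluxM_C1))) _.
    rewrite (partialZ _ _ (C1_sum fluxM_C1)) (partial_sum k fluxM_C1).
    rewrite big1 ?mulr0// => j _; rewrite (partialM k (flux_C1 j) (df_C1 j)).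
    by rewrite flux0 pf0 !mul0r addr0.
have s_gt0 : 0 < sqgrad x.
  by rewrite /sqgrad -enorm_gradient_sqr lt0r s0 sqr_ge0.
rewrite energyE.
have [_ /(_ _ s_gt0) dPhi _ _] := Phi_C2.
apply: is_derive_eq (is_derive_comp_real dPhi (C1_is_partial k x sqgrad_C1)) _.
rewrite partial_sqgrad mulrCA; congr (_ * _); rewrite mulr_sumr.
by apply: eq_bigr => j _; rewrite mulrA flux_coord enorm_gradient_sqr.
Qed.

Lemma partial_energy k : partial k energy =
  (fun x => 2 * \sum_j flux Phi f x ord0 j * partial k (partial j f) x).
Proof. by apply: partialE => x; exact: energy_is_derive. Qed.

Lemma energy_C1 : C1 energy.
Proof.
apply: (C1_of_is_derive energy_is_derive) => k.
apply: continuous_mulr; first exact: cst_continuous.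
apply: continuous_sumr => j; apply: continuous_mulr.
  by apply: C1_continuous; exact: flux_C1.
exact: C1_partial_continuous.
Qed.

Lemma partial_euler j : partial j euler =
  (fun x => partial j f x + \sum_k x ord0 k * partial j (partial k f) x).
Proof.
have eulerE : euler = (fun x => \sum_k x ord0 k * partial k f x).
  by apply/funext => x; rewrite /euler rdotC rdot_gradient; under eq_bigr do rewrite mulrC.
have xdf1 k : C1 (fun x : 'rV[R]_n => x ord0 k * partial k f x).
  exact: C1M (C1_coord k) (df_C1 k).
rewrite eulerE partial_sum//; apply/funext => x.
transitivity (\sum_k (x ord0 k * partial j (partial k f) x +
    partial k f x * (j == k)%:R)).
  apply: eq_bigr => k _.
  by rewrite (partialM j (C1_coord k) (df_C1 k)) partial_coord.
rewrite big_split /= addrC; congr (_ + _).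
rewrite (bigD1 j)//= eqxx mulr1 big1 ?addr0// => k kj.
by rewrite eq_sym (negbTE kj) mulr0.
Qed.

Lemma euler_C1 : C1 euler.
Proof.
apply: C1_sum => k.
rewrite (_ : (fun x : 'rV[R]_n => _) = fun x => x ord0 k * partial k f x).
  exact: C1M (C1_coord k) (df_C1 k).
by apply/funext => x; rewrite mxE.
Qed.

(** The current that Noether's theorem attaches to the dilations of space: the
    stress tensor 2 flux (x) grad f - energy Id applied to the vector x. *)
Definition dilation_field (x : 'rV[R]_n) : 'rV[R]_n :=
  \row_j (2 * (flux Phi f x ord0 j * euler x) - x ord0 j * energy x).

Let dilation_coord j : (fun x => dilation_field x ord0 j) =
  (fun x => 2 * (flux Phi f x ord0 j * euler x) - x ord0 j * energy x).
Proof. by apply/funext => x; rewrite mxE. Qed.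

Let flux_euler_C1 j : C1 (fun x => flux Phi f x ord0 j * euler x).
Proof. exact: C1M (flux_C1 j) euler_C1. Qed.

Let coord_energy_C1 j : C1 (fun x => x ord0 j * energy x).
Proof. exact: C1M (C1_coord j) energy_C1. Qed.

Lemma dilation_field_C1 : C1_field dilation_field.
Proof.
by move=> j; rewrite dilation_coord; exact: C1D (C1Z 2 (flux_euler_C1 j)) (C1N (coord_energy_C1 j)).
Qed.

(** Second derivatives of f enter through the gradient of [euler] and through
    the gradient of [energy]; by the symmetry of the Hessian the two
    contributions cancel. *)
Lemma divergence_dilation_field x : divergence dilation_field x =
  2 * rdot (flux Phi f x) (gradient f x) - n%:R * energy x
  + 2 * (divergence (flux Phi f) x * euler x).
Proof.
have pjE j : partial j (fun y => dilation_field y ord0 j) x =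
    2 * (flux Phi f x ord0 j * partial j f x) - energy x
    + 2 * (partial j (fun y => flux Phi f y ord0 j) x * euler x)
    + (2 * (flux Phi f x ord0 j * \sum_k x ord0 k * partial j (partial k f) x)
      - 2 * (x ord0 j * \sum_k flux Phi f x ord0 k * partial j (partial k f) x)).
  rewrite dilation_coord (partialD _ (C1Z 2 (flux_euler_C1 j)) (C1N (coord_energy_C1 j))).
  rewrite (partialZ _ _ (flux_euler_C1 j)) (partialN _ (coord_energy_C1 j)).
  rewrite (partialM j (flux_C1 j) euler_C1) (partialM j (C1_coord j) energy_C1).
  rewrite partial_coord eqxx mulr1 partial_euler partial_energy.
  move: (flux Phi f x ord0 j) (partial j (fun y => flux Phi f y ord0 j) x)
    (partial j f x) (energy x) (euler x) (x ord0 j) (\sum_k _) (\sum_k _).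
  by move=> *; ring.
rewrite /divergence (eq_bigr _ (fun j _ => pjE j)) big_split /= [X in _ + X](_ : _ = 0).
  rewrite addr0 big_split /= sumrB -!mulr_sumr -mulr_suml -rdot_flux_gradient.
  by rewrite sumr_const card_ord -[energy x *+ n]mulr_natl.
rewrite sumrB -!mulr_sumr; apply/eqP; rewrite subr_eq0; apply/eqP; congr (_ * _).
under eq_bigr do rewrite mulr_sumr.
under [RHS]eq_bigr do rewrite mulr_sumr.
rewrite exchange_big /=; apply: eq_bigr => k _; apply: eq_bigr => j _.
by rewrite (Schwarz x j k f_C2) mulrCA.
Qed.

Lemma rdot_dilation_field x : rdot x (dilation_field x) =
  2 * (rdot x (flux Phi f x) * euler x) - rdot x x * energy x.
Proof.
rewrite /rdot mulr_suml mulr_sumr [X in _ - X]mulr_suml -sumrB.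
by apply: eq_bigr => j _; rewrite mxE; ring.
Qed.

End energy_density.

(** * The Pohozaev identity *)

Section sphere_int_theory.
Context {R : realType} {n : nat}.
Implicit Types (f g : 'rV[R]_n -> R) (r c : R).

Lemma sphere_intB f g r : 0 < r -> continuous f -> continuous g ->
  sphere_int (fun x => f x - g x) r = sphere_int f r - sphere_int g r.
Proof.
move=> /ltW r0 cf cg; rewrite /sphere_int -mulrBr; congr (_ * _).
by apply: RintegralB; [exact: measurable_eball|exact: radial_proj_eball_integrable
  |exact: radial_proj_eball_integrable].
Qed.

Lemma sphere_intZ c f r : 0 < r -> continuous f ->
  sphere_int (fun x => c * f x) r = c * sphere_int f r.
Proof.
move=> /ltW r0 cf; rewrite /sphere_int mulrCA; congr (_ * _).
by apply: RintegralZl; [exact: measurable_eball|exact: radial_proj_eball_integrable].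
Qed.

Lemma sphere_int_ge0 f r : 0 < r -> (forall x, 0 <= f x) -> 0 <= sphere_int f r.
Proof.
move=> r0 f0; apply: mulr_ge0; first by rewrite divr_ge0// ltW.
exact: Rintegral_ge0.
Qed.

End sphere_int_theory.

Section Pohozaev.
Context {R : realType} {n m : nat}.
Variable Phi : R -> R.
Hypothesis Phi_C2 : C2_Rplus Phi.
Hypothesis Phi0 : Phi 0 = 0.
Hypothesis Phi_gt0 : forall s : R, 0 < s -> 0 < Phi s.
Hypothesis dPhi_gt0 : forall s : R, 0 < s -> 0 < Phi^`()%classic s.
Hypothesis Phi_elliptic :
  forall s : R, 0 < s -> 0 < Phi^`()%classic s + 2 * s * Phi^`(2)%classic s.
Variables (H : 'I_m -> 'rV[R]_m -> R) (Ht : 'rV[R]_m -> R).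
Hypothesis H_C1 : forall i, C1 (H i).
Hypothesis Ht_partial : forall (i : 'I_m) (v : 'rV[R]_m),
  derivable Ht v (basis_vec i) /\ partial i Ht v = H i v.
Variable u : 'rV[R]_n -> 'rV[R]_m.
Hypothesis u_sol : classical_solution Phi H u.

Let u_C2 i : C2 (component u i).
Proof. by have [] := u_sol i. Qed.

Let flux_C1 i : C1_field (flux Phi (component u i)).
Proof. by have [] := u_sol i. Qed.

Let u_C1 i : C1 (component u i) := (u_C2 i).1.

Let div_flux i x : divergence (flux Phi (component u i)) x = - H i (u x).
Proof. by have [_ _ <-] := u_sol i; rewrite opprK. Qed.

Definition potential (x : 'rV[R]_n) : R := Ht (u x).

Definition total_energy (x : 'rV[R]_n) : R :=
  \sum_(i < m) energy Phi (component u i) x.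

Definition lagrangian (x : 'rV[R]_n) : R := total_energy x - 2 * potential x.

Definition work (x : 'rV[R]_n) : R :=
  \sum_(i < m) rdot (flux Phi (component u i) x) (gradient (component u i) x).

Definition radial_work (x : 'rV[R]_n) : R :=
  \sum_(i < m) rdot x (flux Phi (component u i) x) * euler (component u i) x.

Let Ht_C1 : C1 Ht.
Proof.
move=> i; split=> [v|]; first by have [] := Ht_partial i v.
rewrite (_ : partial i Ht = H i); first exact: C1_continuous.
by apply/funext => v; have [] := Ht_partial i v.
Qed.

Let potential_is_derive k x : is_derive x (basis_vec k) potential
  (\sum_i H i (u x) * partial k (component u i) x).
Proof.
have := is_derive_comp_rV Ht_C1 (fun i => C1_is_partial k x (u_C1 i)).
congr is_derive; apply: eq_bigr => i _; congr (_ * _).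
by have [] := Ht_partial i (u x).
Qed.

Let u_continuous : continuous u.
Proof.
move=> x; apply/(@cvgrPdist_le R 'rV[R]_m 'rV[R]_n (nbhs x)) => e e0.
have near_e : \forall y \near nbhs x, forall i, `|component u i x - component u i y| <= e.
  apply: (@filter_forall _ _ (fun i y => `|component u i x - component u i y| <= e) (nbhs x)) => i.
  have /cvgrPdist_le := C1_continuous (u_C1 i) (x := x); exact.
apply: filterS near_e => y ye; apply: norm_le_coord => [|i]; first exact: ltW.
by rewrite !mxE; exact: ye.
Qed.

Lemma potential_C1 : C1 potential.
Proof.
apply: (C1_of_is_derive potential_is_derive) => k.
apply: continuous_sumr => i; apply: continuous_mulr.
  move=> x; apply: (@continuous_comp _ _ _ u (H i)); first exact: u_continuous.
  exact: C1_continuous.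
exact: (C1_partial_continuous (u_C1 i)).
Qed.

Let energy_C1i i : C1 (energy Phi (component u i)).
Proof. exact: (energy_C1 Phi_C2 Phi0 Phi_gt0 dPhi_gt0 Phi_elliptic (u_C2 i) (flux_C1 i)). Qed.

Lemma total_energy_continuous : continuous total_energy.
Proof. by apply: continuous_sumr => i; exact: C1_continuous. Qed.

Lemma lagrangian_C1 : C1 lagrangian.
Proof. exact: (C1D (C1_sum energy_C1i) (C1N (C1Z 2 potential_C1))). Qed.

Let lagrangian_continuous : continuous lagrangian.
Proof. exact: C1_continuous lagrangian_C1. Qed.

Let euler_C1i i : C1 (euler (component u i)) := euler_C1 (u_C2 i).

Lemma radial_work_continuous : continuous radial_work.
Proof.
apply: continuous_sumr => i; apply: continuous_mulr; last exact: C1_continuous.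
exact: C1_continuous (C1_rdot_field (flux_C1 i)).
Qed.

Lemma work_continuous : continuous work.
Proof.
apply: continuous_sumr => i; apply: continuous_sumr => j; apply: continuous_mulr.
  exact: C1_continuous (flux_C1 i j).
rewrite (_ : (fun x => _) = partial j (component u i)).
  exact: (C1_partial_continuous (u_C1 i)).
by apply/funext => x; rewrite mxE.
Qed.

(** The dilation current of the whole system: the potential contributes the
    field 2 Ht(u) x. *)
Let W (x : 'rV[R]_n) : 'rV[R]_n :=
  \row_j (\sum_(i < m) dilation_field Phi (component u i) x ord0 j
          + x ord0 j * (2 * potential x)).

Let W_coord j : (fun x => W x ord0 j) =
  (fun x => \sum_(i < m) dilation_field Phi (component u i) x ord0 j
          + x ord0 j * (2 * potential x)).
Proof. by apply/funext => x; rewrite mxE. Qed.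

Let dilation_C1 i : C1_field (dilation_field Phi (component u i)).
Proof.
exact: (dilation_field_C1 Phi_C2 Phi0 Phi_gt0 dPhi_gt0 Phi_elliptic (u_C2 i) (flux_C1 i)).
Qed.

Let pot2_C1 : C1 (fun x => 2 * potential x) := C1Z 2 potential_C1.

Let W_C1 : C1_field W.
Proof.
move=> j; rewrite W_coord.
exact: (C1D (C1_sum (fun i => dilation_C1 i j)) (C1M (C1_coord j) pot2_C1)).
Qed.

(** The terms H_i(u) (x . grad u_i) coming from the equations and from the
    gradient of the potential cancel. *)
Let divergence_W x : divergence W x = 2 * work x - n%:R * lagrangian x.
Proof.
have pjE j : partial j (fun y => W y ord0 j) x =
    \sum_(i < m) partial j (fun y => dilation_field Phi (component u i) y ord0 j) x
    + (2 * potential x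
       + 2 * \sum_(i < m) H i (u x) * (x ord0 j * partial j (component u i) x)).
  rewrite W_coord (partialD j (C1_sum (fun i => dilation_C1 i j))
    (C1M (C1_coord j) pot2_C1)).
  rewrite (partial_sum j (fun i => dilation_C1 i j)); congr (_ + _).
  rewrite (partialM j (C1_coord j) pot2_C1) partial_coord eqxx mulr1 addrC.
  congr (_ + _); rewrite (partialZ _ _ potential_C1) (partialE (potential_is_derive j)).
  rewrite mulrCA; congr (_ * _); rewrite mulr_sumr.
  by apply: eq_bigr => i _; rewrite mulrCA.
have H_euler : \sum_(j < n) \sum_(i < m) H i (u x) * (x ord0 j * partial j (component u i) x)
    = \sum_(i < m) H i (u x) * euler (component u i) x.
  rewrite exchange_big /=; apply: eq_bigr => i _; rewrite -mulr_sumr; congr (_ * _).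
  by apply: eq_bigr => j _; rewrite mxE.
have div_i i : \sum_(j < n) partial j (fun y => dilation_field Phi (component u i) y ord0 j) x =
    2 * rdot (flux Phi (component u i) x) (gradient (component u i) x)
    - n%:R * energy Phi (component u i) x
    - 2 * (H i (u x) * euler (component u i) x).
  rewrite -[LHS]/(divergence (dilation_field Phi (component u i)) x).
  rewrite (divergence_dilation_field Phi_C2 Phi0 Phi_gt0 dPhi_gt0 Phi_elliptic
    (u_C2 i) (flux_C1 i)).
  by rewrite div_flux mulNr mulrN.
rewrite /divergence (eq_bigr _ (fun j _ => pjE j)) big_split /= exchange_big /=.
rewrite (eq_bigr _ (fun i _ => div_i i)) !sumrB big_split /= -!mulr_sumr H_euler.
rewrite sumr_const card_ord -[(_ *+ n)]mulr_natl -/(work x) -/(total_energy x) /lagrangian.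
move: (work x) (total_energy x) (potential x) (\sum_i _) => *.
by ring.
Qed.

Let rdot_W x : rdot x (W x) = 2 * radial_work x - rdot x x * lagrangian x.
Proof.
have -> : rdot x (W x) =
  \sum_(i < m) rdot x (dilation_field Phi (component u i) x) + rdot x x * (2 * potential x).
  rewrite /rdot exchange_big /= mulr_suml -big_split; apply: eq_bigr => j _ /=.
  by rewrite mxE mulrDr mulr_sumr mulrA.
rewrite (eq_bigr _ (fun i _ => rdot_dilation_field Phi (component u i) x)).
rewrite sumrB -!mulr_sumr -/(radial_work x) -/(total_energy x) /lagrangian.
by ring.
Qed.

(** The divergence theorem for the dilation current [W]. *)
Lemma Pohozaev r : (0 < n)%N -> 0 < r ->
  r ^+ 2 * sphere_int lagrangian r =
  2 * sphere_int radial_work r + r * (n%:R * ball_int lagrangian r - 2 * ball_int work r).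
Proof.
move=> n0 r0; have cw := work_continuous; have cq := radial_work_continuous.
have := divergence_theorem n0 r0 W_C1.
rewrite (_ : divergence W = (fun x => 2 * work x - n%:R * lagrangian x)); last first.
  by apply/funext => x; exact: divergence_W.
rewrite (_ : (fun x => rdot x (W x)) =
    (fun x => 2 * radial_work x - rdot x x * lagrangian x)); last first.
  by apply/funext => x; exact: rdot_W.
have c2w : continuous (fun x => 2 * work x).
  by apply: continuous_mulr => //; exact: cst_continuous.
have cnl : continuous (fun x => n%:R * lagrangian x).
  by apply: continuous_mulr => //; exact: cst_continuous.
have c2q : continuous (fun x => 2 * radial_work x).
  by apply: continuous_mulr => //; exact: cst_continuous.
have crl : continuous (fun x => rdot x x * lagrangian x).
  by apply: continuous_mulr => //; exact: C1_continuous rdotxx_C1.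
rewrite ball_intB// !ball_intZ// sphere_intB// sphere_intZ// sphere_int_rdotxx//.
by move: (sphere_int _ r) (sphere_int _ r) (ball_int _ r) (ball_int _ r) => a b c d E; lra.
Qed.

End Pohozaev.

(** * Monotonicity of the normalized energy *)

Section weight.
Context {R : realType}.

Lemma powR_subr1 (r a : R) : 0 < r -> r `^ (a - 1) = r `^ a / r.
Proof.
move=> r0; rewrite powRB; last by apply/implyP => _; rewrite gt_eqF.
by rewrite powRr1// ltW.
Qed.

Lemma is_derive_weight (M : R -> R) (r a S : R) : 0 < r -> is_derive r 1 M S ->
  is_derive r 1 (fun s => (s `^ a)^-1 * M s)
    ((r `^ a)^-1 * (S - a / r * M r)).
Proof.
move=> r0 dM.
have ra : r `^ a != 0 by rewrite gt_eqF// powR_gt0.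
have dw := @is_deriveV R (fun s => s `^ a) r _ 1 ra (is_derive1_powR a r0).
apply: is_derive_eq (is_deriveM dw dM) _.
rewrite powR_subr1// -![_ *: _]/(_ * _).
by field; rewrite ra gt_eqF.
Qed.

(** The arithmetic of the conclusion.  Here S, q are the integrals over the sphere of
    the Lagrangian and of the radial work, and L, h, w the integrals over the
    ball of the Lagrangian, of the potential and of the work. *)
Lemma slope_bound (r a alpha S q L h w : R) (nu : R) : 0 < r ->
  a = nu - alpha ->
  r ^+ 2 * S = 2 * q + r * (nu * L - 2 * w) ->
  2 * w <= alpha * (L + 2 * h) ->
  2 / r `^ a * (r ^- 2 * q) - 2 * alpha / r `^ (a + 1) * h <=
  (r `^ a)^-1 * (S - a / r * L).
Proof.
move=> r0 -> pohozaev wle.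
have ra0 : 0 < r `^ (nu - alpha) by rewrite powR_gt0.
have rn0 : r != 0 by rewrite gt_eqF.
rewrite (@powRD _ r (nu - alpha) 1); last by rewrite rn0 implybT.
rewrite powRr1 ?(ltW r0)//.
have SE : S = (2 * q + r * (nu * L - 2 * w)) / r ^+ 2.
  by rewrite -pohozaev mulrAC divff ?mul1r// expf_neq0.
have -> : 2 / r `^ (nu - alpha) * (r ^- 2 * q) - 2 * alpha / (r `^ (nu - alpha) * r) * h =
  (r `^ (nu - alpha))^-1 * (2 * q / r ^+ 2 - 2 * alpha * h / r).
  by field; rewrite rn0 gt_eqF.
rewrite ler_pM2l ?invr_gt0// SE -subr_ge0.
have -> : (2 * q + r * (nu * L - 2 * w)) / r ^+ 2 - (nu - alpha) / r * L -
   (2 * q / r ^+ 2 - 2 * alpha * h / r) = (alpha * (L + 2 * h) - 2 * w) / r.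
  by field.
by rewrite divr_ge0 ?(ltW r0)// subr_ge0.
Qed.

End weight.

Section monotonicity.
Context {R : realType} {n m : nat}.
Variable Phi : R -> R.
Hypothesis Phi_C2 : C2_Rplus Phi.
Hypothesis Phi0 : Phi 0 = 0.
Hypothesis Phi_gt0 : forall s : R, 0 < s -> 0 < Phi s.
Hypothesis dPhi_gt0 : forall s : R, 0 < s -> 0 < Phi^`()%classic s.
Variable u : 'rV[R]_n -> 'rV[R]_m.
Variable alpha : R.
Hypothesis alpha_ge : (alpha_star Phi <= alpha%:E)%E.

(** The definition of alpha^*, used at s = |grad u_i| ^ 2 for every i. *)
Lemma work_le_energy x : 2 * work Phi u x <= alpha * total_energy Phi u x.
Proof.
rewrite /work /total_energy !mulr_sumr; apply: ler_sum => i _.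
rewrite rdot_flux -enorm_sqr /energy.
have : 0 <= enorm (gradient (component u i) x) ^+ 2 by exact: sqr_ge0.
move: (_ ^+ 2) => s; rewrite le_eqVlt => /predU1P[<-|s0].
  by rewrite Phi0 !mulr0.
by rewrite mulrA mulrAC; exact: (alpha_bound Phi_gt0 alpha_ge).
Qed.

Lemma radial_work_ge0 x : 0 <= radial_work Phi u x.
Proof.
apply: sumr_ge0 => i _.
rewrite /euler rdotC rdot_flux (rdotC x) -mulrA -expr2.
have [s0|s0] := eqVneq (enorm (gradient (component u i) x) ^+ 2) 0.
  have -> : gradient (component u i) x = 0.
    by apply/eqP; rewrite -enorm_eq0 -sqrf_eq0 s0.
  by rewrite rdotC raddf0 expr0n mulr0.
by rewrite mulr_ge0 ?sqr_ge0// ltW// dPhi_gt0// lt0r s0 sqr_ge0.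
Qed.

Lemma surface_radial_derivative r : (0 < n)%N -> 0 < r ->
  (forall i, C1 (component u i)) -> continuous (radial_work Phi u) ->
  \int[surface_measure r]_(x in esphere r)
    (\sum_(i < m) Phi^`()%classic (enorm (gradient (component u i) x) ^+ 2)
       * radial_derivative (component u i) x ^+ 2) =
  r ^- 2 * sphere_int (radial_work Phi u) r.
Proof.
move=> n0 r0 u1 cq.
rewrite -sphere_intZ// -surface_integralE//; last first.
  by apply: continuous_mulr => //; exact: cst_continuous.
apply: eq_Rintegral => x /set_mem xr.
rewrite /radial_work mulr_sumr; apply: eq_bigr => i _.
rewrite /radial_derivative C1_deriveE// rdotZr xr /euler.
rewrite (rdotC x (flux _ _ _)) rdot_flux (rdotC x).
by rewrite exprMn exprVn mulrCA -mulrA -expr2.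
Qed.

End monotonicity.

Theorem theorem2p2 (R : realType) (n m : nat) (n_ge1 : (1 <= n)%N)
  (m_ge2 : (2 <= m)%N)
  (Phi : R -> R)
  (Phi_C2 : C2_Rplus Phi)
  (Phi0 : Phi 0 = 0)
  (Phi_gt0 : forall s : R, 0 < s -> 0 < Phi s)
  (dPhi_gt0 : forall s : R, 0 < s -> 0 < Phi^`()%classic s)
  (Phi_elliptic : forall s : R, 0 < s -> 0 < Phi^`()%classic s + 2 * s * Phi^`(2)%classic s)
  (H : 'I_m -> 'rV[R]_m -> R)
  (H_C1 : forall i : 'I_m, C1 (H i))
  (H_sym : forall (i j : 'I_m) (v : 'rV[R]_m), (i <= j)%N ->
     0 < partial i (H j) v * partial j (H i) v)
  (Ht : 'rV[R]_m -> R)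
  (Ht_partial : forall (i : 'I_m) (v : 'rV[R]_m),
     derivable Ht v (basis_vec i) /\ partial i Ht v = H i v)
  (u : 'rV[R]_n -> 'rV[R]_m)
  (u_sol : classical_solution Phi H u)
  (Ht_le0 : forall x : 'rV[R]_n, Ht (u x) <= 0)
  (alpha : R)
  (alpha_ge : (alpha_star Phi <= alpha%:E)%E) :
  (forall r s : R, 0 < r -> r <= s ->
     I_alpha Phi Ht u alpha r <= I_alpha Phi Ht u alpha s) /\
  (forall r : R, 0 < r ->
     derivable (I_alpha Phi Ht u alpha) r 1 /\
     2 / r `^ (n%:R - alpha) *
       (\int[surface_measure r]_(x in esphere r)
          (\sum_(i < m) Phi^`()%classic (enorm (gradient (component u i) x) ^+ 2)
             * radial_derivative (component u i) x ^+ 2))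
     - 2 * alpha / r `^ (n%:R - alpha + 1) *
       (\int[lebesgue_rV n]_(x in eball r) Ht (u x))
     <= (I_alpha Phi Ht u alpha)^`()%classic r).
Proof.
have n0 : (0 < n)%N by [].
set L := lagrangian Phi Ht u.
set q := radial_work Phi u.
have u1 i : C1 (component u i) by have [[]] := u_sol i.
have cq : continuous q by exact: (radial_work_continuous u_sol).
have cE : continuous (total_energy Phi u).
  exact: (total_energy_continuous Phi_C2 Phi0 Phi_gt0 dPhi_gt0 Phi_elliptic u_sol).
have cw : continuous (work Phi u) by exact: (work_continuous u_sol).
have ch : continuous (potential Ht u).
  exact: (C1_continuous (potential_C1 H_C1 Ht_partial u_sol)).
have cL : continuous L.
  exact: (C1_continuous (lagrangian_C1 Phi_C2 Phi0 Phi_gt0 dPhi_gt0 Phi_elliptic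
    H_C1 Ht_partial u_sol)).
pose slope (r : R) := (r `^ (n%:R - alpha))^-1 *
  (sphere_int L r - (n%:R - alpha) / r * ball_int L r).
have dI (r : R) : 0 < r -> is_derive r 1 (I_alpha Phi Ht u alpha) (slope r).
  by move=> r0; exact: (is_derive_weight (n%:R - alpha) r0 (ball_int_derive r0 cL)).
have slopeE (r : R) : 0 < r -> (I_alpha Phi Ht u alpha)^`()%classic r = slope r.
  by move=> r0; rewrite derive1E; have [_ ->] := dI r r0.
(* the lower bound of the derivative claimed in the theorem *)
pose low (r : R) := 2 / r `^ (n%:R - alpha) * (r ^- 2 * sphere_int q r)
  - 2 * alpha / r `^ (n%:R - alpha + 1) * ball_int (potential Ht u) r.
have low_le (r : R) : 0 < r -> low r <= slope r.
  move=> r0.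
  have poh := Pohozaev Phi_C2 Phi0 Phi_gt0 dPhi_gt0 Phi_elliptic H_C1 Ht_partial
    u_sol n0 r0.
  have workle : 2 * ball_int (work Phi u) r <=
      alpha * (ball_int L r + 2 * ball_int (potential Ht u) r).
    have -> : ball_int L r + 2 * ball_int (potential Ht u) r = ball_int (total_energy Phi u) r.
      rewrite -ball_intZ// -ball_intD//; last first.
        by apply: continuous_mulr => //; exact: cst_continuous.
      by apply: eq_ball_int => x _; rewrite /L /lagrangian subrK.
    rewrite -!ball_intZ//; apply: le_ball_int => [||x].
    - by apply: continuous_mulr => //; exact: cst_continuous.
    - by apply: continuous_mulr => //; exact: cst_continuous.
    - exact: work_le_energy.
  exact: (slope_bound r0 erefl poh workle).
have low_ge0 (r : R) : 0 < r -> 0 <= low r.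
  move=> r0; apply: addr_ge0.
    rewrite mulr_ge0 ?divr_ge0 ?powR_ge0// mulr_ge0 ?invr_ge0 ?sqr_ge0//.
    by apply: sphere_int_ge0 => // x; exact: radial_work_ge0.
  rewrite -mulrN mulr_ge0//.
    by rewrite divr_ge0 ?powR_ge0// mulr_ge0// ltW// (alpha_gt0 Phi_gt0 dPhi_gt0 alpha_ge).
  rewrite oppr_ge0 -[leRHS](mul0r (ball_int (potential Ht u) r)).
  rewrite -ball_intZ//.
  apply: le_ball_int => // [|x]; first by apply: continuous_mulr => //; exact: cst_continuous.
  by rewrite mul0r; exact: Ht_le0.
split=> [r s r0 rs|r r0].
  have posi x : x \in `[r, s] -> 0 < x.
    by rewrite in_itv/= => /andP[rx _]; exact: lt_le_trans rx.
  apply: (@ger0_derive1_ndecr _ (I_alpha Phi Ht u alpha) r s) => //.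
  - by move=> x /subset_itv_oo_cc/posi x0; have [] := dI x x0.
  - move=> x /subset_itv_oo_cc/posi x0; rewrite slopeE//.
    by rewrite (le_trans (low_ge0 x x0))// low_le.
  - apply: derivable_within_continuous => x /posi x0.
    by have [] := dI x x0.
split; first by have [] := dI r r0.
rewrite slopeE// surface_radial_derivative//.
exact: low_le.
Qed.
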